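(* In the setting of the context, suppose that: (1) $f$, $g\circ T$ and $h$ belong to $\Gamma_0(\mathcal H_p)$; (2) the pair $(f,\mathcal C)$ is $(F,\zeta)$-smooth for some $F:\mathcal H_p\to\mathbb R\cup\{+\infty\}$ and $\zeta:]0,1]\to\mathbb R_+$; (3) $\mathcal C=\mathrm{dom}(h)$ is weakly compact; (4) $T\mathcal C\subset \mathrm{dom}(\partial g)$ and $\sup_{x\in\mathcal C}\|[\partial g(Tx)]^0\|<\infty$; (5) $h$ is Lipschitz continuous relative to $\mathcal C$ with constant $L_h\ge0$, i.e. $|h(x)-h(z)|\le L_h\|x-z\|$ for all $x,z\in\mathcal C$; (6) there exists a saddle point of $\mathcal L$ in $\mathcal H_p\times\mathcal H_d$; (7) $\mathrm{ran}(A)$ is closed; (8) either (a) $A^{-1}(b)\cap\mathrm{int}(\mathrm{dom}(g\circ T))\cap\mathrm{int}(\mathcal C)\ne\emptyset$, or (b) $\mathcal H_p$ and $\mathcal H_d$ are finite dimensional, $A^{-1}(b)\cap\mathrm{ri}(\mathrm{dom}(g\circ T))\cap\mathrm{ri}(\mathcal C)\ne\emptyset$ and $\mathrm{ran}(A^* )\cap\mathrm{LinHull}(\mathrm{dom}(g\circ T)\cap\mathcal C)^\perp=\{0\}$. Suppose the parameters satisfy: (9) $(\gamma_k)\subset\,]0,1]$ and the sequences $(\zeta(\gamma_k))_k$, $(\gamma_k^2/\beta_k)_k$, $(\gamma_k\beta_k)_k$ belong to $\ell^1_+$; (10) $(\gamma_k)_k\notin\ell^1$; (11) $(\beta_k)_k$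 is non-increasing and converges to $0$; (12) $(\rho_k)_k$ is non-decreasing with $0<\underline\rho=\inf_k\rho_k\le\sup_k\rho_k=\overline\rho<+\infty$; (13) for some constants $\underline M_\gamma\geq 1$ and $\overline M_\gamma>0$, $\underline M_\gamma\le\inf_k(\gamma_k/\gamma_{k+1})\le\sup_k(\gamma_k/\gamma_{k+1})\le\overline M_\gamma$; (14) $\theta_k=\gamma_k/c$ for all $k\in\mathbb N$, for some $c>0$ such that $\overline M_\gamma/c-\underline\rho/2<0$; (15) $\rho_{k+1}-\rho_k-\gamma_{k+1}\rho_{k+1}+\frac2c\gamma_k-\frac{\gamma_k^2}{c}\le\gamma_{k+1}$ for all $k\in\mathbb N$, with the same $c$. Let $(x_k)_k,(\mu_k)_k$ be the primal and dual sequences generated by the algorithm in the context, let $(x^\star,\mu^\star)$ be a saddle point of $\mathcal L$, and let $\Gamma_k=\sum_{i=0}^k\gamma_i$. Then: (0) $Ax_k\to b$ strongly; $\inf_{0\le i\le k}\|Ax_i-b\|=O(1/\sqrt{\Gamma_k})$ and there is a subsequence with $\|Ax_{k_j}-b\|\le1/\sqrt{\Gamma_{k_j}}$ for all $j$; and $\big\|A\big(\sum_{i=0}^k\gamma_ix_i/\Gamma_k\big)-b\big\|=O(1/\sqrt{\Gamma_k})$. (i) $\lim_{k\to\infty}\mathcal L(x_k,\mu^\star)=\mathcal L(x^\star,\mu^\star)$. (ii) Every weak cluster point $\bar x$ of $(x_k)_k$ is a solution of the primal problem, and $(\mu_k)_k$ converges weakly to some $\bar\mu$ that solves the dual problem;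 i.e. $(\bar x,\bar\mu)$ is a saddle point of $\mathcal L$. (iii) $\inf_{0\le i\le k}\mathcal L(x_i,\mu^\star)-\mathcal L(x^\star,\mu^\star)=O(1/\Gamma_k)$, and there exists a subsequence $(x_{k_j})_{j}$ such that for each $j\in\mathbb N$, $\mathcal L(x_{k_j+1},\mu^\star)-\mathcal L(x^\star,\mu^\star)\le1/\Gamma_{k_j}$. (iv) With $\bar x_k=\sum_{i=0}^k\gamma_ix_{i+1}/\Gamma_k$ for each $k\in\mathbb N$, $\mathcal L(\bar x_k,\mu^\star)-\mathcal L(x^\star,\mu^\star)=O(1/\Gamma_k)$.
   Context: Setting. $\mathcal H_p,\mathcal H_d,\mathcal H_v$ are real Hilbert spaces, $A:\mathcal H_p\to\mathcal H_d$ and $T:\mathcal H_p\to\mathcal H_v$ are bounded linear operators, $b\in\mathcal H_d$, and $f,h:\mathcal H_p\to\mathbb R\cup\{+\infty\}$, $g:\mathcal H_v\to\mathbb R\cup\{+\infty\}$ are proper, convex, lower semicontinuous, with $\mathcal C:=\mathrm{dom}(h)$ weakly compact. Primal problem: $\min_{x\in\mathcal H_p}\{f(x)+g(Tx)+h(x):Ax=b\}$. Dual problem: $\min_{\mu\in\mathcal H_d}(f+g\circ T+h)^*(-A^*\mu)+\langle\mu,b\rangle$, where $^*$ on functions is the Legendre–Fenchel conjugate. $\Gamma_0(\mathcal H)$ is the set of proper convex lower semicontinuous functions $\mathcal H\to\mathbb R\cup\{+\infty\}$. Lagrangian: $\mathcal L(x,\mu)=f(x)+g(Tx)+h(x)+\langle\mu,Ax-b\rangle$;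 $(x^\star,\mu^\star)$ is a saddle point if $\mathcal L(x^\star,\mu)\le\mathcal L(x^\star,\mu^\star)\le\mathcal L(x,\mu^\star)$ for all $(x,\mu)$. For $x\in\mathrm{dom}(\partial g)=\{x:\partial g(x)\ne\emptyset\}$, $[\partial g(x)]^0$ is the element of minimal norm of the subdifferential $\partial g(x)$. $\mathrm{ri}$ is the relative interior; $\mathrm{LinHull}(S)$ is the linear subspace parallel to the affine hull of $S$; $A^{-1}(b)$ is the pre-image of $b$ under $A$. $(G,\zeta)$-smoothness: Let $G:\mathcal H\to\mathbb R\cup\{+\infty\}$ and $\zeta:]0,1]\to\mathbb R_+$. A pair $(q,\mathcal C)$ with $q:\mathcal H\to\mathbb R\cup\{+\infty\}$ and $\mathcal C\subset\mathrm{dom}(q)$ is $(G,\zeta)$-smooth if there is an open set $\mathcal C_0$ with $\mathcal C\subset\mathcal C_0\subset\mathrm{int}(\mathrm{dom}(G))$ such that $G$ and $q$ are differentiable on $\mathcal C_0$, $G-q$ is convex on $\mathcal C_0$, and $K_{(G,\zeta,\mathcal C)}:=\sup\{D_G(z,x)/\zeta(\gamma): x,s\in\mathcal C,\ \gamma\in]0,1],\ z=x+\gamma(s-x)\}<+\infty$, where $D_G(z,x)=G(z)-G(x)-\langle\nabla G(x),z-x\rangle$. Algorithm. Given $x_0\in\mathcal C$, $\mu_0\in\mathrm{ran}(A)$ and non-negative real sequences $(\gamma_k),(\beta_k),(\theta_k),(\rho_k)$ (with $\beta_k>0$), iterate for $k=0,1,2,\dots$: $y_k=\mathrm{prox}_{\beta_kg}(Tx_k)$;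 $z_k=\nabla f(x_k)+T^*(Tx_k-y_k)/\beta_k+A^*\mu_k+\rho_kA^*(Ax_k-b)$; $s_k\in\mathrm{Argmin}_{s\in\mathcal H_p}\{h(s)+\langle z_k,s\rangle\}$; $x_{k+1}=x_k-\gamma_k(x_k-s_k)$; $\mu_{k+1}=\mu_k+\theta_k(Ax_{k+1}-b)$. Here $\mathrm{prox}_{q}(x)=\mathrm{argmin}_y\{q(y)+\frac12\|x-y\|^2\}$. $\ell^1$ is the space of absolutely summable real sequences and $\ell^1_+$ the set of its non-negative elements. $\mathbb N=\{0,1,2,\dots\}$. *)

(* Defs.v *)
From HB Require Import structures.
From mathcomp Require Import all_boot all_order all_algebra.
From mathcomp Require Import all_classical all_reals all_analysis.

Set Implicit Arguments.
Unset Strict Implicit.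
Unset Printing Implicit Defensive.

Import Order.TTheory GRing.Theory Num.Theory.
Import numFieldNormedType.Exports.

Local Open Scope classical_set_scope.
Local Open Scope ring_scope.

(* Completeness is that of the norm, and [norm_inner] ties the norm to the
   inner product. *)
HB.mixin Record CompleteNormedModule_isHilbert (R : realType) (H : Type)
    of CompleteNormedModule R H := {
  inner : {dot H for @idfun R} ;
  norm_inner : forall x : H, `|x| ^+ 2 = inner x x
}.

#[short(type="hilbertType")]
HB.structure Definition Hilbert (R : realType) :=
  {H of CompleteNormedModule_isHilbert R H & CompleteNormedModule R H}.

Definition dotp (R : realType) (H : hilbertType R) (x y : H) : R :=
  (inner : {dot H for @idfun R}) x y.

(* The coarsest topology for which every [dotp ^~ y] is continuous. *)
Definition weak_topology (R : realType) (H : hilbertType R) : Type := H.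

Definition weak_topology_def (R : realType) (H : hilbertType R) :=
  sup_topology (fun y : H =>
    Topological.class (initial_topology (fun x : H => dotp x y))).

HB.instance Definition _ (R : realType) (H : hilbertType R) :=
  Topological.copy (weak_topology H) (weak_topology_def H).

Section Weak.
Context {R : realType} {H : hilbertType R}.

Definition weakly_compact (C : set H) := @compact (weak_topology H) C.

Definition weak_cvg (u : nat -> H) (l : H) :=
  (u : nat -> weak_topology H) @ \oo --> (l : weak_topology H).

Definition weak_cluster_point (u : nat -> H) (l : H) :=
  @cluster (weak_topology H) ((u : nat -> weak_topology H) @ \oo) l.

End Weak.

(* Functions into R U {+oo} are functions into [\bar R] that never take the
   value -oo. The objects that are unique when they exist (proximal point,
   minimal subgradient, gradient, adjoint) are picked by [xget 0], whose value
   is the junk point 0 when there is no such object. *)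
Section ConvexAnalysis.
Context {R : realType} {H : hilbertType R}.
Implicit Types (f q G : H -> \bar R) (x y u : H) (C S M : set H).
Local Open Scope ereal_scope.

Definition dom f : set H := [set x | f x < +oo].

Definition eproper f := (forall x, -oo < f x) /\ dom f !=set0.

Definition econvex f := forall x y (t : R), (0 < t < 1)%R ->
  f (t *: x + (1 - t) *: y)%R <= t%:E * f x + (1 - t)%:E * f y.

Definition Gamma0 f := [/\ eproper f, econvex f & lower_semicontinuous f].

Definition argmin f : set H := [set x | forall y, f x <= f y].

Definition prox q x : H :=
  xget 0%R (argmin (fun y => q y + (2^-1 * `|x - y| ^+ 2)%:E)).

Definition conjugate f u : \bar R :=
  ereal_sup [set (dotp u x)%:E - f x | x in setT].

Definition subdiff f x : set H :=
  [set u | forall y, f x + (dotp u (y - x))%:E <= f y].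

Definition dom_subdiff f : set H := [set x | subdiff f x !=set0].

Definition min_subgradient f x : H :=
  xget 0%R [set u | subdiff f x u /\
                    forall v, subdiff f x v -> (`|u| <= `|v|)%R].

(* Frechet differentiability; [f] has to be finite around [x] because
   [fine] sends +oo to 0. *)
Definition ediff f x :=
  (dom f)° x /\ differentiable (fine \o f : H -> R) x.

Definition gradient f x : H :=
  xget 0%R [set u | forall v, 'd (fine \o f : H -> R) x v = dotp u v].

Definition Bregman G y x : \bar R :=
  G y - G x - (dotp (gradient G x) (y - x))%:E.

(* The quotient is the one of [\bar R]: where [zeta gamma = 0] it is +oo when
   the Bregman divergence is positive and 0 when the latter is 0. *)
Definition smoothness_const G (zeta : R -> R) C : \bar R :=
  ereal_sup [set e | exists x s (gamma : R),
    [/\ C x, C s, (0 < gamma <= 1)%R &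
        e = Bregman G (x + gamma *: (s - x))%R x / (zeta gamma)%:E]].

(* [C0] need not be convex, so convexity on [C0] is required on the convex
   subsets of [C0]. *)
Definition Gzeta_smooth G (zeta : R -> R) q C :=
  C `<=` dom q /\
  exists C0 : set H,
    [/\ open C0, C `<=` C0, C0 `<=` (dom G)°,
        (forall x, C0 x -> ediff G x /\ ediff q x) &
        (forall K : set H, K `<=` C0 -> convex_set K ->
           convex_function K (fun x => fine (G x) - fine (q x))%R)] /\
    smoothness_const G zeta C < +oo.

Definition affine_set M := forall x y (t : R), M x -> M y ->
  M (x + t *: (y - x))%R.

Definition affine_hull S : set H :=
  [set x | forall M, affine_set M -> S `<=` M -> M x].

(* Interior of [S] in the topology induced on its affine hull. *)
Definition rel_interior S : set H :=
  [set x | S x /\ exists2 V, nbhs x V & V `&` affine_hull S `<=` S].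

Definition LinHull S : set H :=
  [set z | exists x y, [/\ affine_hull S x, affine_hull S y & z = (x - y)%R]].

Definition orth S : set H := [set u | forall v, S v -> dotp u v = 0%R].

Definition finite_dim (V : lmodType R) :=
  exists (n : nat) (e : 'I_n -> V),
    forall v, exists c : 'I_n -> R, v = (\sum_(i < n) c i *: e i)%R.

End ConvexAnalysis.

Definition adjoint (R : realType) (H K : hilbertType R) (A : H -> K) (y : K) : H :=
  xget 0 [set x | forall u, dotp (A u) y = dotp u x].

Section Problem.
Context {R : realType} {Hp Hd Hv : hilbertType R}.
Variables (A : Hp -> Hd) (T : Hp -> Hv) (b : Hd).
Variables (f h : Hp -> \bar R) (g : Hv -> \bar R).
Local Open Scope ereal_scope.

Definition objective (x : Hp) : \bar R := f x + g (T x) + h x.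

Definition Lagrangian (x : Hp) (mu : Hd) : \bar R :=
  f x + g (T x) + h x + (dotp mu (A x - b))%:E.

Definition saddle_point (xs : Hp) (mus : Hd) := forall x mu,
  Lagrangian xs mu <= Lagrangian xs mus /\
  Lagrangian xs mus <= Lagrangian x mus.

Definition primal_solution (x : Hp) :=
  A x = b /\ forall x', A x' = b -> objective x <= objective x'.

Definition dual_solution : set Hd :=
  argmin (fun mu => conjugate objective (- adjoint A mu)%R + (dotp mu b)%:E).

Local Open Scope ring_scope.

Record iterates (gamma beta theta rho : nat -> R)
    (x : nat -> Hp) (y : nat -> Hv) (z s : nat -> Hp) (mu : nat -> Hd) : Prop := {
  iter_x0 : dom h (x 0%N) ;
  iter_mu0 : range A (mu 0%N) ;
  iter_y : forall k, y k = prox (fun v => (beta k)%:E * g v)%E (T (x k)) ;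
  iter_z : forall k, z k =
    gradient f (x k) + (beta k)^-1 *: adjoint T (T (x k) - y k)
    + adjoint A (mu k) + rho k *: adjoint A (A (x k) - b) ;
  iter_s : forall k, argmin (fun v => h v + (dotp (z k) v)%:E)%E (s k) ;
  iter_x : forall k, x k.+1 = x k - gamma k *: (x k - s k) ;
  iter_mu : forall k, mu k.+1 = mu k + theta k *: (A (x k.+1) - b)
}.

End Problem.

Definition ell1 (R : realType) (u : nat -> R) :=
  cvgn (series (fun k => `|u k|)).

Definition ell1_plus (R : realType) (u : nat -> R) :=
  (forall k, 0 <= u k) /\ ell1 u.

(* u_k = O(v_k) for an extended real sequence u; in particular u_k is
   eventually finite. *)
Definition ebigO (R : realType) (u : nat -> \bar R) (v : nat -> R) :=
  exists M : R, \forall k \near \oo, (`|u k| <= (M * `|v k|)%:E)%E.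

(* Main.v *)
Require Import Defs.
From HB Require Import structures.
From mathcomp Require Import all_boot all_order all_algebra.
From mathcomp Require Import all_classical all_reals all_analysis.
From mathcomp Require Import ring lra.

Set Implicit Arguments.
Unset Strict Implicit.
Unset Printing Implicit Defensive.

Import Order.TTheory GRing.Theory Num.Theory.
Import numFieldNormedType.Exports.

Local Open Scope classical_set_scope.
Local Open Scope ring_scope.

(* Fix a saddle point (xs, mus), put e_k = A x_k - b, let Phi_k be the objective P
   at x_k with g replaced by its Moreau envelope of parameter beta_k, and let
   V_k = Phi_k + <mu_k, e_k> + rho_k/2 |e_k|^2 - P(xs) be the gap of the smoothed
   augmented Lagrangian at x_k. A conditional gradient step compared with xs,
   together with |mu_{k+1} - mus|^2 expanded along the dual update, shows that
   (1 - gamma_k) V_k + c/2 |mu_k - mus|^2 - gamma_k rho_k/2 |e_k|^2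
   decreases, up to summable errors, by
   gamma_k (Phi_{k+1} + <mus, e_{k+1}> - P(xs)) + rho_inf/2 gamma_k |e_{k+1}|^2.
   The error (gamma_k - gamma_{k+1}) V_{k+1} is absorbed by a discrete Gronwall
   argument, since V is at most quadratic in |mu - mus|; the error
   (rho_{k+1} - rho_k)/2 |e_{k+1}|^2 telescopes. Hence the multipliers are
   bounded, gamma_k |e_{k+1}|^2 and gamma_k times the Lagrangian gap are
   summable, and |mu_k - mus| converges for every dual solution mus. The rates
   follow from convexity and the divergence of the series of gamma. A descent
   step compared with an arbitrary w in dom h shows that weak limits of mu_k
   are dual solutions, so that Opial's lemma gives weak convergence. *)

(** * Hilbert spaces *)

(** Moving the multiplier from [mu_k] to [mu_{k+1}] adds [theta_k |e_{k+1}|^2] to [V_{k+1}]. This is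
    paid by the looseness of the linearized penalty at a feasible comparison point,
    [gamma rho / 2 |e|^2], which becomes available only one iteration later: hence the negative term
    in the energy and the demand [Mhi / c < inf rho / 2], where [Mhi] accounts for the delay. The
    weight [1 - gamma_k] removes [gamma_k <mu_k - mus, e_{k+1}>] from the pairing, and the cross
    term of [c / 2 |mu_{k+1} - mus|^2] restores exactly that, since [c theta_k = gamma_k].
    Summability against [gamma] controls [|e_k|^2] and the gap along a subsequence only. The whole
    sequences converge because a step raises them by at most a constant times [gamma_k], by
    convexity and boundedness of [dom h]. Then [V_k] tends to [0], which turns convergence of the
    energy into convergence of [|mu_k - mus|]. *)

Section inner_product.
Context {R : realType} {H : hilbertType R}.
Implicit Types x y z u : H.

Lemma dotpC x y : dotp x y = dotp y x.
Proof. by rewrite /dotp hermC expr0 mul1r. Qed.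

Lemma dotpDr x y z : dotp x (y + z) = dotp x y + dotp x z.
Proof. by rewrite /dotp linearDr. Qed.

Lemma dotpZr (a : R) x y : dotp x (a *: y) = a * dotp x y.
Proof. by rewrite /dotp linearZr. Qed.

Lemma dotpNr x y : dotp x (- y) = - dotp x y.
Proof. by rewrite -scaleN1r dotpZr mulN1r. Qed.

Lemma dotp0r x : dotp x 0 = 0.
Proof. by rewrite -(scale0r x) dotpZr mul0r. Qed.

Lemma dotpBr x y z : dotp x (y - z) = dotp x y - dotp x z.
Proof. by rewrite dotpDr dotpNr. Qed.

Lemma dotpDl x y z : dotp (x + y) z = dotp x z + dotp y z.
Proof. by rewrite dotpC dotpDr !(dotpC z). Qed.

Lemma dotpZl (a : R) x y : dotp (a *: x) y = a * dotp x y.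
Proof. by rewrite dotpC dotpZr dotpC. Qed.

Lemma dotpNl x y : dotp (- x) y = - dotp x y.
Proof. by rewrite dotpC dotpNr dotpC. Qed.

Lemma dotp0l x : dotp 0 x = 0.
Proof. by rewrite dotpC dotp0r. Qed.

Lemma dotpBl x y z : dotp (x - y) z = dotp x z - dotp y z.
Proof. by rewrite dotpDl dotpNl. Qed.

Definition dotpE := (dotpDl, dotpDr, dotpNl, dotpNr, dotpZl, dotpZr, dotp0l,
  dotp0r).

Lemma dotpp x : dotp x x = `|x| ^+ 2.
Proof. by rewrite norm_inner. Qed.

Lemma sqr_normD x y : `|x + y| ^+ 2 = `|x| ^+ 2 + 2 * dotp x y + `|y| ^+ 2.
Proof. by rewrite -!dotpp !dotpE (dotpC y x); ring. Qed.

Lemma sqr_normB x y : `|x - y| ^+ 2 = `|x| ^+ 2 - 2 * dotp x y + `|y| ^+ 2.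
Proof. by rewrite sqr_normD dotpNr normrN mulrN. Qed.

Lemma sqr_normZ (a : R) x : `|a *: x| ^+ 2 = a ^+ 2 * `|x| ^+ 2.
Proof. by rewrite normrZ exprMn real_normK ?num_real. Qed.

Lemma dotp_le_norm x y : dotp x y <= `|x| * `|y|.
Proof.
have [->|x0] := eqVneq x 0; first by rewrite dotp0l normr0 mul0r.
have nx : 0 < `|x| by rewrite normr_gt0.
(* Expanded, this square is [2 |x| |y| (|x| |y| - dotp x y)]. *)
have /= := sqr_ge0 `| `|y| *: x - `|x| *: y|.
rewrite sqr_normB !sqr_normZ !dotpE => h.
have [->|y0] := eqVneq y 0; first by rewrite dotp0r normr0 mulr0.
have ny : 0 < `|y| by rewrite normr_gt0.
have xy := mulr_gt0 nx ny.
rewrite -subr_ge0 -(pmulr_rge0 _ xy); nra.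
Qed.

Lemma norm_dotp_le x y : `|dotp x y| <= `|x| * `|y|.
Proof.
by rewrite ler_norml dotp_le_norm andbT lerNl -dotpNl -(normrN x) dotp_le_norm.
Qed.

Lemma dotp_continuous x : continuous (dotp x).
Proof.
move=> y; apply/cvgrPdist_le => e e0; near=> z.
rewrite -dotpBr (le_trans (norm_dotp_le _ _))//.
have h : `|x| * `|y - z| <= (`|x| + 1) * `|y - z|.
  by rewrite ler_wpM2r// lerDl.
rewrite (le_trans h)// mulrC -ler_pdivlMr ?ltr_wpDl//.
near: z; apply: cvgr_dist_le; first exact: cvg_id.
by rewrite divr_gt0// ltr_wpDl.
Unshelve. all: by end_near. Qed.

Lemma dotp_inj x y : (forall u, dotp x u = dotp y u) -> x = y.
Proof.
move=> /(_ (x - y)) /eqP; rewrite -subr_eq0 -dotpBl dotpp sqrf_eq0 normr_eq0.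
by rewrite subr_eq0 => /eqP.
Qed.

Lemma sqr_norm_mid x y : `|2^-1 *: (x + y)| ^+ 2 =
  2^-1 * `|x| ^+ 2 + 2^-1 * `|y| ^+ 2 - 4^-1 * `|x - y| ^+ 2.
Proof. by rewrite sqr_normZ sqr_normB sqr_normD; field. Qed.

Lemma linear_bound (K : normedModType R) (B : {linear H -> K}) :
  continuous B -> exists2 M, 0 <= M & forall x, `|B x| <= M * `|x|.
Proof.
move=> /(_ 0) /continuous_linear_bounded => /(_ 0).
move=> /linear_boundedP h; near (pinfty_nbhs R) => M.
exists M; first by near: M; exact: nbhs_pinfty_ge.
by near: M.
Unshelve. all: by end_near. Qed.

End inner_product.

Section lower_semicontinuity.
Context {R : realType} {X : topologicalType}.
Local Open Scope ereal_scope.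
Implicit Types (f g : X -> \bar R).

Lemma lte_add_split (a b : \bar R) (r : R) : -oo < a -> -oo < b ->
  r%:E < a + b -> exists s t, [/\ s%:E < a, t%:E < b & (r <= s + t)%R].
Proof.
case: a b => [a| |] [b| |]//= _ _.
- rewrite -EFinD lte_fin => rab.
  exists (a - (a + b - r) / 2)%R, (b - (a + b - r) / 2)%R.
  by rewrite !lte_fin; split; lra.
- by move=> _; exists (a - 1)%R, (r - a + 1)%R; rewrite lte_fin ltry; split=> //; lra.
- by move=> _; exists (r - b + 1)%R, (b - 1)%R; rewrite lte_fin ltry; split=> //; lra.
- by move=> _; exists r, 0%R; rewrite !ltry addr0; split.
Qed.

Lemma lower_semicontinuousD f g : (forall x, -oo < f x) ->
  (forall x, -oo < g x) -> lower_semicontinuous f -> lower_semicontinuous g ->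
  lower_semicontinuous (f \+ g).
Proof.
move=> fNy gNy fl gl x a /(lte_add_split (fNy x) (gNy x)) [s [t [sf tg ast]]].
have [V Vx fV] := fl _ _ sf; have [W Wx gW] := gl _ _ tg.
exists (V `&` W); first exact: filterI.
move=> y [Vy Wy]; apply: (@le_lt_trans _ _ (s%:E + t%:E)).
  by rewrite -EFinD lee_fin.
by apply: lteD; [exact: fV|exact: gW].
Qed.

Lemma lower_semicontinuous_fin (f : X -> R) :
  continuous f -> lower_semicontinuous (EFin \o f).
Proof.
move=> cf x a; rewrite /= lte_fin => afx.
exists (f @^-1` [set r | (a < r)%R]) => //.
by apply: cf; apply: (open_nbhs_nbhs); split => //; exact: open_gt.
Qed.

Lemma lower_semicontinuousZ (k : R) f : (0 < k)%R ->
  lower_semicontinuous f -> lower_semicontinuous (fun x => k%:E * f x).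
Proof.
move=> k0 fl x a; rewrite -lte_pdivrMl// -EFinM => /fl[V Vx h].
by exists V => // y /h; rewrite EFinM lte_pdivrMl.
Qed.

End lower_semicontinuity.

(** * Minimization of strongly convex functions, Riesz representation, projection *)

Section strongly_convex.
Context {R : realType} {H : hilbertType R}.
Implicit Types (q : H -> \bar R).

(* A minimizing sequence is Cauchy by strong midpoint convexity, and its limit
   is a minimizer by lower semicontinuity. *)
Lemma strongly_convex_argmin q (m k : R) : lower_semicontinuous q ->
  dom q !=set0 -> (forall x, m%:E <= q x)%E -> 0 < k ->
  (forall x y, dom q x -> dom q y ->
    q (2^-1 *: (x + y)) + (k * `|x - y| ^+ 2)%:E <=
    (2^-1 * (fine (q x) + fine (q y)))%:E)%E ->
  argmin q !=set0.
Proof.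
move=> ql [x0 qx0] qm k0 qmid.
have qfin x : dom q x -> q x \is a fin_num.
  by move=> qx; rewrite fin_numE -ltey qx -ltNye (lt_le_trans _ (qm x))// ltNyr.
pose S := [set fine (q x) | x in dom q].
have Sinf : has_inf S.
  split; first by exists (fine (q x0)), x0.
  by exists m => _ [x qx <-]; rewrite -lee_fin fineK//; exact: qfin.
have Ile x : ((inf S)%:E <= q x)%E.
  have [qx|] := boolP (q x < +oo)%E; last by rewrite -leNgt leye_eq => /eqP->; rewrite leey.
  rewrite -(fineK (qfin _ qx)) lee_fin; apply: (ge_inf (proj2 Sinf)).
  by exists x.
have hn (n : nat) : exists x, dom q x /\ fine (q x) < inf S + n.+1%:R^-1.
  have n0 : (0 : R) < n.+1%:R^-1 by rewrite invr_gt0.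
  have [_ [x qx <-] h] := inf_adherent n0 Sinf.
  by exists x.
have [u uP] := choice hn.
have ucauchy n p : (n <= p)%N -> k * `|u n - u p| ^+ 2 <= n.+1%:R^-1.
  move=> np; have [dn qn] := uP n; have [dp qp] := uP p.
  have : ((inf S)%:E + (k * `|u n - u p| ^+ 2)%:E <= (2^-1 * (fine (q (u n)) + fine (q (u p))))%:E)%E.
    apply: le_trans (qmid _ _ dn dp); exact: leeD2r.
  rewrite -EFinD lee_fin => h.
  have : (p.+1%:R^-1 : R) <= n.+1%:R^-1.
    by rewrite lef_pV2 ?posrE ?ltr0n// ler_nat.
  by move: qn qp h; move: (n.+1%:R^-1) (p.+1%:R^-1) => i j; lra.
have : cvg (u @ \oo).
  apply: cauchy_cvg; apply: cauchy_exP => e e0.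
  pose d := k * e ^+ 2.
  have d0 : 0 < d by rewrite mulr_gt0// exprn_gt0.
  have [N _ hN] := near_infty_natSinv_lt (PosNum d0).
  exists (u N); exists N => // p /= Np; rewrite -ball_normE /=.
  have h := ucauchy _ _ Np.
  have h2 : N.+1%:R^-1 < d := hN N (leqnn _).
  rewrite -ltr_sqr ?nnegrE// ?ltW//.
  by rewrite -(ltr_pM2l k0) (le_lt_trans h).
set l := lim _ => ul; exists l => y; apply: le_trans (Ile y).
rewrite leNgt; apply/negP => Il.
have [e e0 he] : exists2 e, 0 < e & ((inf S + e)%:E < q l)%E.
  move: Il; case: (q l) => [r| |]//.
  - by rewrite lte_fin => h; exists ((r - inf S) / 2); rewrite ?lte_fin; lra.
  - by exists 1 => //; rewrite ltry.
have [V Vl Vq] := ql _ _ he.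
have [N _ hN] := near_infty_natSinv_lt (PosNum e0).
have [N' _ hN'] := ul _ Vl.
have := Vq _ (hN' (maxn N N') (leq_maxr _ _)).
have [du qu] := uP (maxn N N').
rewrite -(fineK (qfin _ du)) lte_fin => h.
have /= h2 := hN (maxn N N') (leq_maxl _ _).
by move: qu h2 h; move: (_.+1%:R^-1) => i; lra.
Qed.


(** The passage from minimality along a segment to a variational inequality: it gives the optimality
    conditions of the Riesz vector, the projection and the proximal point, and later removes the
    quadratic penalty from the dual limit. *)
Lemma first_order_ge0 (w B : R) :
  (forall t, 0 < t < 1 -> 0 <= t * w + t ^+ 2 * B) -> 0 <= w.
Proof.
move=> h; rewrite leNgt; apply/negP => w0.
have B0 : 0 < 2 * (`|B| + 1) - w by have := normr_ge0 B; lra.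
(* This [t] satisfies [2 t (|B| + 1) = - w (1 - t)], so that [w + t |B| < 0]. *)
have t0 : 0 < - w / (2 * (`|B| + 1) - w) by rewrite divr_gt0// oppr_gt0.
have t1 : - w / (2 * (`|B| + 1) - w) < 1.
  by rewrite ltr_pdivrMr// mul1r; have := normr_ge0 B; lra.
have tE : - w / (2 * (`|B| + 1) - w) * (2 * (`|B| + 1) - w) = - w.
  by rewrite divfK// gt_eqF.
have := h _ (introT andP (conj t0 t1)).
move: t0 t1 tE; set t := _ / _ => t0 t1 tE.
rewrite expr2 -mulrA -mulrDr pmulr_rge0//.
have : t * B <= t * `|B| by rewrite ler_pM2l// ler_norm.
have : 0 <= t * `|B| by rewrite mulr_ge0// ltW.
nra.
Qed.

(** The representing vector is the minimizer of [|x|^2 / 2 - l x]: its first-order condition in the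
    directions [w] and [- w] is the equality sought. *)
Lemma riesz (l : H -> R) (M : R) : (forall x y, l (x + y) = l x + l y) ->
  (forall a x, l (a *: x) = a * l x) -> (forall x, `|l x| <= M * `|x|) ->
  exists u, forall x, l x = dotp u x.
Proof.
move=> lD lZ lM.
have lN x : l (- x) = - l x by rewrite -scaleN1r lZ mulN1r.
have l0 : l 0 = 0 by rewrite -(scale0r 0) lZ mul0r.
pose M1 := `|M| + 1.
have M10 : 0 < M1 by rewrite ltr_wpDl.
have lM1 x : `|l x| <= M1 * `|x|.
  by rewrite (le_trans (lM x))// ler_wpM2r// (le_trans (ler_norm _))// lerDl.
have lc : continuous l.
  move=> y; apply/cvgrPdist_le => e e0; near=> z.
  rewrite -lN -lD (le_trans (lM1 _))// mulrC -ler_pdivlMr//.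
  near: z; apply: cvgr_dist_le; first exact: cvg_id.
  by rewrite divr_gt0.
pose q x := (2^-1 * `|x| ^+ 2 - l x)%:E.
have [u umin] : argmin q !=set0.
  (* The lower bound completes the square in [|x|^2 / 2 - M1 |x|]. The gap [8^-1] is half the [4^-1]
     of the parallelogram identity, the linear part contributing nothing. *)
  apply: (@strongly_convex_argmin q (- 2^-1 * M1 ^+ 2) 8^-1).
  - apply: (lower_semicontinuous_fin (f := fun x => 2^-1 * `|x| ^+ 2 - l x)).
    move=> x; apply: cvgB; last exact: lc.
    apply: cvgMr; rewrite expr2; under eq_fun do rewrite expr2.
    by apply: cvgM; apply: cvg_norm; exact: cvg_id.
  - by exists 0; rewrite /dom /= ltry.
  - move=> x; rewrite lee_fin.
    have := ler_norm (l x); have := lM1 x; have := sqr_ge0 (`|x| - M1); nra.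
  - by [].
  - move=> x y _ _; rewrite /q /= -EFinD lee_fin sqr_norm_mid lZ lD; lra.
exists u => v.
have key w : 0 <= dotp u w - l w.
  apply: (first_order_ge0 (B := 2^-1 * `|w| ^+ 2)) => t t01.
  have := umin (u + t *: w); rewrite /q lee_fin sqr_normD lD lZ sqr_normZ !dotpE.
  lra.
apply/eqP; rewrite eq_le -subr_ge0 key /= -subr_ge0.
by have := key (- v); rewrite dotpNr lN opprK addrC.
Unshelve. all: by end_near. Qed.

(** The constraint is encoded by the value [+oo] off [S]; closedness of [S] then becomes lower
    semicontinuity and convexity the midpoint inequality. *)
Lemma projection (S : set H) (p : H) : closed S -> S !=set0 ->
  (forall x y t, 0 < t < 1 -> S x -> S y -> S (t *: x + (1 - t) *: y)) ->
  exists2 q, S q & forall y, S y -> dotp (p - q) (y - q) <= 0.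
Proof.
move=> Scl [x0 Sx0] Scv.
pose q x := if x \in S then (2^-1 * `|x - p| ^+ 2)%:E else +oo%E.
have [u umin] : argmin q !=set0.
  apply: (@strongly_convex_argmin q 0 8^-1).
  - move=> x a; rewrite /q; case: ifPn => xS; last first.
      move=> _; exists (~` S).
        apply: open_nbhs_nbhs; split; first exact: closed_openC.
        by move=> /mem_set; apply/negP.
      by move=> y Sy; rewrite memNset// ltry.
    pose r y := 2^-1 * `|y - p| ^+ 2.
    have rc : continuous r.
      move=> z; apply: cvgMr; rewrite expr2; under eq_fun do rewrite expr2.
      by apply: cvgM; apply: cvg_norm; apply: cvgB; [exact: cvg_id|exact: cvg_cst|exact: cvg_id|exact: cvg_cst].
    move=> /(lower_semicontinuous_fin rc)[V Vx h].
    by exists V => // y /h /= ?; case: ifP => // _; rewrite ltry.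
  - by exists x0; rewrite /dom /q /= mem_set// ltry.
  - by move=> x; rewrite /q; case: ifP => _; rewrite ?leey// lee_fin mulr_ge0.
  - by [].
  - move=> x y; rewrite /dom /q /=; case: ifPn => // /set_mem xS _.
    case: ifPn => // /set_mem yS _.
    have -> : 2^-1 *: (x + y) \in S.
      rewrite scalerDr {2}(_ : 2^-1 = 1 - 2^-1); last by lra.
      by apply/mem_set/Scv => //; lra.
    rewrite -EFinD lee_fin /=.
    have -> : 2^-1 *: (x + y) - p = 2^-1 *: ((x - p) + (y - p)).
      rewrite addrACA -opprD scalerBr; congr (_ - _).
      by rewrite -(mulr2n p) -(scaler_nat 2 p) scalerA mulVf// scale1r.
    rewrite sqr_norm_mid (_ : x - p - (y - p) = x - y); last first.
      by rewrite opprB addrA subrK.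
    lra.
have uS : u \in S.
  apply: contraPT (umin x0) => /negPf uS; rewrite /q uS mem_set//.
exists u; first exact: set_mem.
move=> y Sy; rewrite -oppr_ge0.
apply: (first_order_ge0 (B := 2^-1 * `|y - u| ^+ 2)) => t t01.
have := umin (t *: y + (1 - t) *: u).
rewrite /q uS mem_set; last by apply: Scv => //; exact: set_mem.
have -> : t *: y + (1 - t) *: u - p = (u - p) + t *: (y - u).
  by apply: dotp_inj => w; rewrite !dotpE; ring.
rewrite lee_fin (sqr_normD (u - p)) sqr_normZ -(opprB u p).
rewrite dotpNl dotpZr; lra.
Qed.

End strongly_convex.

(** * Weak topology and convex functions *)

Section weak.
Context {R : realType} {H : hilbertType R}.

Lemma weak_nbhs (l w : H) (e : R) : 0 < e ->
  nbhs (l : weak_topology H) [set y | `|dotp y w - dotp l w| < e].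
Proof.
move=> e0.
pose Tc := fun y : H => Topological.class (initial_topology (fun x : H => dotp x y)).
have /(@cvg_sup _ _ Tc (nbhs (l : weak_topology H)) l) : 
  nbhs (l : weak_topology H) --> (l : weak_topology H) by exact: cvg_id.
move=> /(_ w); apply => /=.
exists [set y | `|dotp y w - dotp l w| < e]; split => //=.
  exists (ball (dotp l w) e); first exact: ball_open.
  by apply/seteqP; split => y; rewrite -ball_normE /= distrC.
by rewrite subrr normr0.
Qed.

Lemma weak_cvgP (u : nat -> H) (l : H) :
  (forall w, dotp (u k) w @[k --> \oo] --> dotp l w) -> weak_cvg u l.
Proof.
move=> h.
pose Tc := fun y : H => Topological.class (initial_topology (fun x : H => dotp x y)).
apply/(@cvg_sup _ _ Tc _ l) => w V /=.
move=> [W [[B oB <-] Bl] WV].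
have [N _ hN] : \forall k \near \oo, B (dotp (u k) w).
  exact: (h w B (open_nbhs_nbhs (conj oB Bl))).
by exists N => // k Nk; apply: WV; exact: hN.
Qed.

(** The projection [q] of [l] on [S] supplies the separating functional [dotp (l - q)]: on [S] it
    stays below its value at [q], while points of [S] weakly close to [l] bring it near its value at
    [l]. Hence [|l - q|^2 <= 0]. *)
Lemma weak_cluster_closed_convex (S : set H) (u : nat -> H) (l : H) :
  closed S -> (forall x y t, 0 < t < 1 -> S x -> S y ->
    S (t *: x + (1 - t) *: y)) ->
  (\forall k \near \oo, S (u k)) -> weak_cluster_point u l -> S l.
Proof.
move=> Scl Scv Su ul.
have S0 : S !=set0 by have [N _ h] := Su; exists (u N); apply: h => /=.
have [q Sq hq] := projection l Scl S0 Scv.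
suff : `|l - q| ^+ 2 <= 0.
  have := sqr_ge0 `|l - q|; move=> h1 h2.
  have /eqP : `|l - q| ^+ 2 == 0 by rewrite eq_le h1 h2.
  by move/eqP; rewrite sqrf_eq0 normr_eq0 subr_eq0 => /eqP ->.
apply/ler_addgt0Pl => e e0; rewrite addr0.
have Fu : ((u : nat -> weak_topology H) @ \oo) (S : set (weak_topology H)) by exact: Su.
have [y [Sy]] := ul _ _ Fu (weak_nbhs l (l - q) e0).
rewrite /= ltr_norml (dotpC y) (dotpC l) => /andP[h _].
rewrite -dotpp dotpBr; have := hq _ Sy; rewrite dotpBr; lra.
Qed.

Lemma weak_cluster_dotp (u : nat -> H) (l w : H) (r : R) :
  weak_cluster_point u l -> dotp (u k) w @[k --> \oo] --> r -> dotp l w = r.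
Proof.
move=> ul ur; apply/eqP; rewrite -subr_eq0 -normr_le0.
apply/ler_addgt0Pl => e e0; rewrite addr0.
have e2 : 0 < e / 2 by rewrite divr_gt0.
have Fu : ((u : nat -> weak_topology H) @ \oo)
    ([set y | `|dotp y w - r| < e / 2] : set (weak_topology H)).
  have /cvgrPdist_lt /(_ _ e2) := ur.
  by apply: filterS => k /=; rewrite distrC.
have [y [/= h1 h2]] := ul _ _ Fu (weak_nbhs l w e2).
by move: h1 h2; rewrite !ltr_norml ler_norml => /andP[? ?] /andP[? ?]; lra.
Qed.

(** Each pairing with a fixed [y] is weakly continuous, hence bounded on [C]. So the functionals
    [dotp x], for [x] in [C], are pointwise bounded, and Banach-Steinhaus bounds them on the unit
    ball, in particular at [x / |x|]. *)
Lemma weakly_compact_bounded (C : set H) : weakly_compact C ->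
  exists2 d, 0 <= d & forall x, C x -> `|x| <= d.
Proof.
move=> Cc.
have pb : pointwise_bounded ([set (dotp x : H -> R^o) | x in C]).
  move=> y.
  have : compact ((fun x : weak_topology H => dotp x y : R^o) @` C).
    apply: (@continuous_compact (weak_topology H) R (fun x => dotp x y) C) => //.
    apply: continuous_subspaceT.
    move=> l V /nbhs_ballP[e /= e0 eV].
    apply: (@filterS _ _ (nbhs_filter (l : weak_topology H)) _ _ _ (weak_nbhs l y e0)).
    by move=> z zb; apply: eV; rewrite -ball_normE /= distrC.
  move=> /compact_bounded [M [_ hM]].
  by exists (M + 1) => _ [x Cx <-]; apply: (hM (M + 1)); [rewrite ltrDl|exists x].
have [f [x Cx <-]|M hM] := @Banach_Steinhauss R H R^o _ _ pb 1.
  split; last by move=> a y z; rewrite dotpDr dotpZr.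
  move=> r; exists (`|x| * r) => y yr.
  by rewrite (le_trans (norm_dotp_le _ _))// ler_wpM2l.
exists `|M| => // x Cx.
have [->|x0] := eqVneq x 0; first by rewrite normr0.
have nx : 0 < `|x| by rewrite normr_gt0.
have := hM (dotp x) (ex_intro2 _ _ x Cx erefl) (`|x|^-1 *: x).
rewrite normrZ ger0_norm ?invr_ge0// mulVf ?gt_eqF// => /(_ (lexx _)).
rewrite dotpZr dotpp expr2 mulrA mulVf ?gt_eqF// mul1r => h.
by rewrite (le_trans (ler_norm _))// (le_trans h)// ler_norm.
Qed.

End weak.

Section adjoint.
Context {R : realType} {H K : hilbertType R}.

(** Riesz representation provides a candidate, so that the choice defining [adjoint] does not fall
    back on its default [0]. The gradient, the minimal subgradient and the proximal point are freed
    from their defaults in the same way. *)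
Lemma adjointP (B : {linear H -> K}) : continuous B ->
  forall u y, dotp (B u) y = dotp u (adjoint B y).
Proof.
move=> Bc u y; have [M M0 BM] := linear_bound Bc.
have [w hw] : exists w, forall x, dotp y (B x) = dotp w x.
  apply: (@riesz _ _ (fun x => dotp y (B x)) (`|y| * M)).
  - by move=> a c; rewrite linearD dotpDr.
  - by move=> a c; rewrite linearZ dotpZr.
  - move=> x; rewrite (le_trans (norm_dotp_le _ _))// -mulrA ler_wpM2l//.
rewrite /adjoint; case: xgetP => [x _ /(_ u) //|/(_ w) /=].
by case => v; rewrite dotpC hw dotpC.
Qed.

End adjoint.

(** * Minimal subgradients and proximal points *)

Section convex.
Context {R : realType} {H : hilbertType R}.
Implicit Types (f g : H -> \bar R).

Lemma eproper_fin f x : eproper f -> dom f x -> f x = (fine (f x))%:E.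
Proof.
by move=> [fNy _] fx; rewrite fineK// fin_numE gt_eqF ?fNy// lt_eqF.
Qed.

Lemma subdiff_dom f x : eproper f -> dom_subdiff f x -> dom f x.
Proof.
move=> [fNy [y fy]] [u /(_ y)]; rewrite /dom /= => h.
have : (f x + (dotp u (y - x))%:E < +oo)%E by exact: le_lt_trans fy.
by case: (f x) (fNy x) => // r; rewrite ltry.
Qed.

Lemma econvex_fin f x y (a b t : R) : econvex f -> f x = a%:E -> f y = b%:E ->
  0 < t < 1 -> (f (t *: x + (1 - t) *: y)%R <= (t * a + (1 - t) * b)%:E)%E.
Proof. by move=> fc fx fy t01; rewrite EFinD !EFinM -fx -fy; exact: fc. Qed.

Lemma subdiff_le f x u y : eproper f -> subdiff f x u -> dom f y -> dom f x ->
  fine (f x) + dotp u (y - x) <= fine (f y).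
Proof.
move=> fp /(_ y) + fy fx; rewrite (eproper_fin fp fx) (eproper_fin fp fy).
by rewrite -EFinD lee_fin.
Qed.

(** The projection of [0] on the subdifferential has least norm. Writing the subdifferential as an
    intersection of half-spaces indexed by [dom f] gives closedness and convexity while handling
    only real values. *)
Lemma min_subgradientP f x : eproper f -> dom_subdiff f x ->
  subdiff f x (min_subgradient f x).
Proof.
move=> fp fx; have dx := subdiff_dom fp fx.
have S_E : subdiff f x = \bigcap_(y in dom f)
    [set u | dotp u (y - x) <= fine (f y) - fine (f x)].
  apply/seteqP; split => u h y.
    by move=> fy; have := subdiff_le fp h fy dx; rewrite /= lerBrDl.
  have [fy|] := boolP (f y < +oo)%E; last first.
    by rewrite -leNgt leye_eq => /eqP ->; rewrite leey.
  have := h _ fy; rewrite /= lerBrDl (eproper_fin fp fy) (eproper_fin fp dx).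
  by rewrite -EFinD lee_fin.
have Scl : closed (subdiff f x).
  rewrite S_E; apply: closed_bigI => y _.
  rewrite (_ : [set _ | _] = (dotp (y - x)) @^-1` [set r | r <= fine (f y) - fine (f x)]).
    apply: closed_comp; last exact: closed_le.
    by move=> z _; exact: dotp_continuous.
  by apply/seteqP; split => u /=; rewrite dotpC.
have [|q Sq hq] := projection 0 Scl fx.
  move=> u v t /andP[t0 t1]; rewrite S_E => hu hv y fy.
  have := hu _ fy; have := hv _ fy; rewrite /= dotpDl !dotpZl; nra.
rewrite /min_subgradient; case: xgetP => [w _ []//|/(_ q)] [].
split => // v Sv; have := hq _ Sv.
rewrite sub0r dotpNl dotpBr dotpp => h.
have := dotp_le_norm q v => h2.
have [->|q0] := eqVneq q 0; first by rewrite normr0.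
have : `|q| * `|q| <= `|q| * `|v| by rewrite -expr2; lra.
by rewrite ler_pM2l// normr_gt0.
Qed.

(** Existence uses strong convexity of the quadratic term, with the affine minorant given by a
    subgradient at [v] as the bound from below. The subgradient at the proximal point comes from
    minimality along the segments leading to each [w]. *)
Lemma prox_subgradient g v (k : R) : Gamma0 g -> 0 < k -> dom_subdiff g v ->
  let y := prox (fun w => k%:E * g w)%E v in
  dom g y /\ subdiff g y (k^-1 *: (v - y)).
Proof.
move=> [gp gc gl] k0 gv.
have dv := subdiff_dom gp gv.
have [u hu] := gv.
pose q w := (k%:E * g w + (2^-1 * `|v - w| ^+ 2)%:E)%E.
have qdom w : dom q w -> dom g w.
  rewrite /dom /q /=; have := proj1 gp w; case: (g w) => [r _ _|_|]; last by [].
    by rewrite ltry.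
  by rewrite gt0_muley ?lte_fin// addye// ltxx.
have qfin w : dom g w -> q w = (k * fine (g w) + 2^-1 * `|v - w| ^+ 2)%:E.
  by move=> gw; rewrite /q (eproper_fin gp gw).
have nc : continuous (fun w : H => 2^-1 * `|v - w| ^+ 2).
  move=> z; apply: cvgMr; rewrite expr2; under eq_fun do rewrite expr2.
  by apply: cvgM; apply: cvg_norm; apply: cvgB; [exact: cvg_cst|exact: cvg_id|exact: cvg_cst|exact: cvg_id].
have midE (x w : H) : 2^-1 *: (x + w) = 2^-1 *: x + (1 - 2^-1) *: w.
  by rewrite scalerDr (_ : 1 - 2^-1 = 2^-1 :> R)//; lra.
have qmin : argmin q !=set0.
  (* With [u] a subgradient at [v], the lower bound is the minimum over [r = v - w] of
     [k (g v - dotp u r) + |r|^2 / 2]. *)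
  apply: (@strongly_convex_argmin _ _ q (k * fine (g v) - 2^-1 * k ^+ 2 * `|u| ^+ 2) 8^-1).
  - apply: (@lower_semicontinuousD _ _ (fun w => k%:E * g w)%E (EFin \o (fun w => 2^-1 * `|v - w| ^+ 2))).
    + by move=> w; have := proj1 gp w; case: (g w) => // [r _|_]; rewrite ?ltNyr// gt0_muley ?lte_fin.
    + by move=> w /=; rewrite ltNyr.
    + exact: lower_semicontinuousZ.
    + exact: lower_semicontinuous_fin.
  - by exists v; rewrite /dom /= qfin// ltry.
  - move=> w; have [gw|] := boolP (g w < +oo)%E; last first.
      rewrite -leNgt leye_eq => /eqP gw.
      by rewrite /q gw gt0_muley ?lte_fin// addye// leey.
    rewrite qfin// lee_fin.
    have := subdiff_le gp hu gw dv.
    rewrite -(opprB v w) dotpNr => h1.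
    have h2 : k * (fine (g v) - dotp u (v - w)) <= k * fine (g w) by rewrite ler_pM2l//; lra.
    have := sqr_ge0 `|k *: u - (v - w)|; rewrite (sqr_normB (k *: u)) sqr_normZ dotpZl; lra.
  - by [].
  - move=> x w /qdom dx /qdom dw.
    have := econvex_fin (t := 2^-1) gc (eproper_fin gp dx) (eproper_fin gp dw).
    move=> /(_ ltac:(lra)); rewrite -midE => h.
    have dm : dom g (2^-1 *: (x + w)) by rewrite /dom /= (le_lt_trans h)// ltry.
    rewrite !qfin// -EFinD lee_fin /=.
    rewrite (eproper_fin gp dm) lee_fin in h.
    have -> : v - 2^-1 *: (x + w) = 2^-1 *: ((v - x) + (v - w)).
      rewrite addrACA -opprD scalerBr; congr (_ - _).
      by rewrite -(mulr2n v) -(scaler_nat 2 v) scalerA mulVf// scale1r.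
    rewrite sqr_norm_mid (_ : v - x - (v - w) = w - x); last first.
      by apply: dotp_inj => r; rewrite !dotpE; ring.
    rewrite (distrC w).
    have : k * fine (g (2^-1 *: (x + w))) <= k * (2^-1 * fine (g x) + (1 - 2^-1) * fine (g w)).
      by rewrite ler_pM2l.
    lra.
move=> y; have ymin : argmin q y.
  rewrite /y /prox; case: xgetP => [w _ //|hn].
  by have [w hw] := qmin; have := hn w.
have dy : dom g y.
  by apply: qdom; rewrite /dom /= (le_lt_trans (ymin v))// qfin// ltry.
split; first exact: dy.
move=> w; have [gw|] := boolP (g w < +oo)%E; last first.
  by rewrite -leNgt leye_eq => /eqP ->; rewrite leey.
rewrite (eproper_fin gp gw) (eproper_fin gp dy) -EFinD lee_fin.
rewrite -subr_ge0.
suff h : 0 <= k * (fine (g w) - fine (g y)) - dotp (v - y) (w - y).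
  rewrite dotpZl -(pmulr_rge0 _ k0) mulrBr mulrDr mulrA mulfV ?gt_eqF// mul1r; lra.
apply: (first_order_ge0 (B := 2^-1 * `|w - y| ^+ 2)) => t t01.
have h := econvex_fin gc (eproper_fin gp gw) (eproper_fin gp dy) t01.
have dm : dom g (t *: w + (1 - t) *: y) by rewrite /dom /= (le_lt_trans h)// ltry.
rewrite (eproper_fin gp dm) lee_fin in h.
have := ymin (t *: w + (1 - t) *: y); rewrite !qfin// lee_fin.
have -> : v - (t *: w + (1 - t) *: y) = (v - y) - t *: (w - y).
  by apply: dotp_inj => x; rewrite !dotpE; ring.
rewrite (sqr_normB (v - y)) sqr_normZ dotpZr.
have : k * fine (g (t *: w + (1 - t) *: y)) <= k * (t * fine (g w) + (1 - t) * fine (g y)).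
  by rewrite ler_pM2l.
lra.
Qed.

End convex.

(** * Smoothness and Moreau envelopes *)

Section smooth.
Context {R : realType} {H : hilbertType R}.
Implicit Types (f F : H -> \bar R).

(** The difference quotients at [0+] are bounded by [phi y - phi x]. Convexity is asked for on the
    segment only, so that the result applies to [F - f], known to be convex merely on convex parts
    of an open set. *)
Lemma convex_diff_le (phi : H -> R) x y : differentiable phi x ->
  (forall t, 0 < t < 1 -> phi (t *: y + (1 - t) *: x) <= t * phi y + (1 - t) * phi x) ->
  phi x + 'd phi x (y - x) <= phi y.
Proof.
move=> dphi phic.
have := @diff_derivable _ _ _ phi x (y - x) dphi.
rewrite /derivable; have -> : 'd phi x (y - x) = 'D_(y - x) phi x by rewrite deriveE.
move=> /cvg_dnbhs_at_right h.
rewrite -lerBrDl; apply: (cvgr_to_le h).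
near=> t.
have t0 : 0 < t by near: t; exact: nbhs_right_gt.
have t1 : t < 1 by near: t; apply: nbhs_right_lt.
rewrite /= [_ *: _]mulrC ler_pdivrMr//.
have -> : t *: (y - x) + x = t *: y + (1 - t) *: x.
  by apply: dotp_inj => w; rewrite !dotpE; ring.
have := phic t (introT andP (conj t0 t1)); lra.
Unshelve. all: by end_near. Qed.

Lemma gradientP f x : ediff f x ->
  forall v, 'd (fine \o f : H -> R) x v = dotp (gradient f x) v.
Proof.
move=> [_ df]; have [M M0 hM] := linear_bound (diff_continuous df).
have [||u hu] := @riesz _ _ ('d (fine \o f : H -> R) x : H -> R) M _ _ hM.
- by move=> a c; rewrite linearD.
- by move=> a c; rewrite linearZ.
by rewrite /gradient; case: xgetP => [w _ //|/(_ u)].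
Qed.

Lemma econvex_dom f x y t : econvex f -> dom f x -> dom f y -> 0 < t < 1 ->
  eproper f -> dom f (t *: x + (1 - t) *: y).
Proof.
move=> fc fx fy t01 fp.
by rewrite /dom /= (le_lt_trans (econvex_fin fc (eproper_fin fp fx) (eproper_fin fp fy) t01))// ltry.
Qed.

Lemma econvex_fine f x y t : eproper f -> econvex f -> dom f x -> dom f y ->
  0 < t < 1 ->
  fine (f (t *: x + (1 - t) *: y)) <= t * fine (f x) + (1 - t) * fine (f y).
Proof.
move=> fp fc fx fy t01.
have := econvex_fin fc (eproper_fin fp fx) (eproper_fin fp fy) t01.
by rewrite (eproper_fin fp (econvex_dom fc fx fy t01 fp)) lee_fin.
Qed.

Lemma convex_dom f : eproper f -> econvex f -> convex_set (dom f).
Proof.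
move=> fp fc; apply/convex_setW => x y xf yf t t0 t1.
apply/mem_set; apply: (econvex_dom (t := t%:num)) => //; rewrite ?t0//; exact: set_mem.
Qed.

Lemma gradient_le f x y : eproper f -> econvex f -> ediff f x -> dom f x ->
  dom f y -> fine (f x) + dotp (gradient f x) (y - x) <= fine (f y).
Proof.
move=> fp fc df fx fy; rewrite -gradientP//; apply: convex_diff_le.
  by case: df.
by move=> t t01; exact: econvex_fine.
Qed.

(** Convexity of [F - f] makes the Bregman divergence of [f] at most that of [F], which the
    smoothness constant bounds by a multiple of [zeta t]. The lower bound is the tangent inequality
    of the convex [f]. *)
Lemma Gzeta_smooth_descent F (zeta : R -> R) f (C : set H) :
  (forall v, -oo < F v)%E -> (forall t, 0 < t <= 1 -> 0 <= zeta t) ->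
  eproper f -> econvex f -> convex_set C -> Gzeta_smooth F zeta f C ->
  C `<=` dom f /\ exists2 K, 0 <= K &
  [/\ forall x y, C x -> C y ->
        fine (f x) + dotp (gradient f x) (y - x) <= fine (f y) &
      forall x s t, C x -> C s -> 0 < t <= 1 ->
        fine (f (x + t *: (s - x))) <=
          fine (f x) + t * dotp (gradient f x) (s - x) + K * zeta t].
Proof.
have arith (Fz Fx fz fx dF df m : R) : Fz - Fx - dF <= m ->
  (Fx - fx) + (dF - df) <= Fz - fz -> fz <= fx + df + m by lra.
move=> FNy z0 fp fc Cc [Cf [C0 [[oC0 CC0 C0F C0d C0c] Kfin]]]; split => //.
pose K := fine (smoothness_const F zeta C).
exists `|K| => //; split.
  move=> x y Cx Cy; apply: gradient_le => //; [|exact: Cf|exact: Cf].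
  by have [] := C0d _ (CC0 _ Cx).
move=> x s t Cx Cs t01; set z := x + t *: (s - x).
have -> : t * dotp (gradient f x) (s - x) = dotp (gradient f x) (z - x).
  by rewrite /z !dotpE; ring.
have Cz : C z.
  have /andP[t0 t1] := t01.
  have /set_mem := Cc _ _ (Itv01 (ltW t0) t1) (mem_set Cs) (mem_set Cx).
  suff -> : conv (Itv01 (ltW t0) t1) (s : convex_lmodType H) x = z by [].
  have -> : conv (Itv01 (ltW t0) t1) (s : convex_lmodType H) x =
    (t *: s + (1 - t) *: x : H) by [].
  by apply: (@dotp_inj _ H) => w; rewrite /z !dotpE; ring.
have [dF df] := C0d _ (CC0 _ Cx).
have [aF EF] : exists a, dotp (gradient F x) (z - x) = a by exists (dotp (gradient F x) (z - x)).
have [af Ef] : exists a, dotp (gradient f x) (z - x) = a by exists (dotp (gradient f x) (z - x)).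
rewrite Ef.
have domF u : C u -> F u = (fine (F u))%:E.
  move=> Cu; rewrite fineK// fin_numE gt_eqF ?FNy// lt_eqF//.
  have := C0F _ (CC0 _ Cu); exact: interior_subset.
have Fz : fine (F z) - fine (F x) - aF <= `|K| * zeta t.
  have : (Bregman F z x / (zeta t)%:E <= smoothness_const F zeta C)%E.
    by apply: ereal_sup_ubound; exists x, s, t.
  rewrite /Bregman domF// (domF x)// EF -!EFinB.
  set D := _ - _ - _.
  (* If [zeta t = 0], a positive divergence would make the quotient [+oo], against finiteness of the
     constant. *)
  have := z0 _ t01; rewrite le_eqVlt => /orP[/eqP <-|zt0].
    rewrite mulr0; have [//|D0] := leP D 0.
    rewrite inve0 gt0_muley ?lte_fin// => h.
    by have := le_lt_trans h Kfin.
  rewrite inver gt_eqF// -EFinM => h.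
  have Kf : smoothness_const F zeta C \is a fin_num.
    by rewrite fin_numE gt_eqF ?lt_eqF// (lt_le_trans _ h)// ltNyr.
  move: h; rewrite -(fineK Kf) lee_fin -/K ler_pdivrMr// => h.
  by rewrite (le_trans h)// ler_wpM2r ?ler_norm// ltW.
apply: (arith _ _ _ _ aF _ _ Fz).
have dF' := proj2 dF; have df' := proj2 df.
pose phi := ((fine \o F : H -> R) \- (fine \o f : H -> R)).
have dphi : differentiable phi x by exact: differentiableB.
have -> : aF - af = 'd phi x (z - x).
  rewrite -deriveE// /phi deriveB; [|exact: diff_derivable|exact: diff_derivable].
  have hF := etrans (gradientP dF (z - x)) EF; have hf := etrans (gradientP df (z - x)) Ef.
  by rewrite -hF -hf; congr (_ - _); rewrite deriveE.
apply: (@convex_diff_le phi) => // a /andP[a0 a1].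
(* The open set [C0] may fail to be convex; the convex subset used is [C] itself. *)
have := C0c C CC0 Cc (Itv01 (ltW a0) (ltW a1)) z x (mem_set Cz) (mem_set Cx).
by [].
Qed.

End smooth.

(* [moreau k v] is the value at [v] of the Moreau envelope of [g] with parameter
   [k], attained at [prox_at k v], and [moreau_grad k v] is its gradient. *)
Section moreau.
Context {R : realType} {H : hilbertType R}.
Variables (g : H -> \bar R) (gG : Gamma0 g).
Implicit Types (v w : H) (k : R).

Definition prox_at k v := prox (fun w => k%:E * g w)%E v.
Definition moreau k v := fine (g (prox_at k v)) + (2 * k)^-1 * `|v - prox_at k v| ^+ 2.
Definition moreau_grad k v := k^-1 *: (v - prox_at k v).

Let gp : eproper g. Proof. by case: gG. Qed.

Lemma moreauE k v : 0 < k ->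
  moreau k v = fine (g (prox_at k v)) + k / 2 * `|moreau_grad k v| ^+ 2.
Proof.
by move=> k0; rewrite /moreau /moreau_grad sqr_normZ; field; rewrite gt_eqF.
Qed.

Lemma sub_prox_at k v : 0 < k -> v - prox_at k v = k *: moreau_grad k v.
Proof. by move=> k0; rewrite /moreau_grad scalerA mulfV ?gt_eqF// scale1r. Qed.

Lemma moreau_grad_le k v w : 0 < k -> dom_subdiff g v -> dom g w ->
  fine (g (prox_at k v)) + dotp (moreau_grad k v) (w - prox_at k v) <= fine (g w).
Proof.
move=> k0 gv gw; have [dy sy] := prox_subgradient gG k0 gv.
exact: subdiff_le.
Qed.

(** The comparison is with [g w] and not with the envelope at [w], so that the comparison point
    enters the descent with its true objective. *)
Lemma moreau_minorant k v w : 0 < k -> dom_subdiff g v -> dom g w ->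
  moreau k v + dotp (moreau_grad k v) (w - v) <= fine (g w).
Proof.
move=> k0 gv gw; rewrite moreauE//.
have h := moreau_grad_le k0 gv gw.
have -> : w - v = (w - prox_at k v) - k *: moreau_grad k v.
  by rewrite -sub_prox_at//; apply: dotp_inj => r; rewrite !dotpE; ring.
rewrite dotpBr dotpZr dotpp.
have : 0 <= k * `|moreau_grad k v| ^+ 2 by rewrite mulr_ge0// ltW.
lra.
Qed.

(** Adding the subgradient inequalities at [v] and at the proximal point gives [|a|^2 <= dotp u a]
    for the gradient [a]. The bound does not depend on [k], so it survives [k] tending to [0]. *)
Lemma moreau_grad_norm k v u : 0 < k -> dom_subdiff g v -> subdiff g v u ->
  `|moreau_grad k v| <= `|u|.
Proof.
move=> k0 gv uv; have dv := subdiff_dom gp gv.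
have [dy sy] := prox_subgradient gG k0 gv.
have h1 := subdiff_le gp uv dy dv.
have h2 := moreau_grad_le k0 gv dv.
have E := sub_prox_at v k0.
rewrite -(opprB v) dotpNr E dotpZr in h1; rewrite E dotpZr dotpp in h2.
have : k * (`|moreau_grad k v| ^+ 2) <= k * dotp u (moreau_grad k v) by rewrite /prox_at in h1 h2 *; lra.
rewrite ler_pM2l// => h3; have h4 := dotp_le_norm u (moreau_grad k v).
have [->|q0] := eqVneq (moreau_grad k v) 0; first by rewrite normr0.
have : `|moreau_grad k v| * `|moreau_grad k v| <= `|u| * `|moreau_grad k v|.
  by rewrite -expr2; lra.
by rewrite ler_pM2r// normr_gt0.
Qed.

Lemma moreau_le k v : 0 < k -> dom_subdiff g v -> moreau k v <= fine (g v).
Proof.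
move=> k0 gv; have := moreau_minorant k0 gv (subdiff_dom gp gv).
by rewrite subrr dotp0r addr0.
Qed.

Lemma le_moreau k v u : 0 < k -> subdiff g v u ->
  fine (g v) <= moreau k v + k / 2 * `|u| ^+ 2.
Proof.
move=> k0 uv; have gv : dom_subdiff g v by exists u.
have [dy sy] := prox_subgradient gG k0 gv.
have := subdiff_le gp uv dy (subdiff_dom gp gv).
rewrite moreauE// -(opprB v) dotpNr sub_prox_at// dotpZr => h.
have := sqr_ge0 `|moreau_grad k v - u|; rewrite sqr_normB (dotpC _ u) => h2.
have : 0 <= k * (`|moreau_grad k v| ^+ 2 - 2 * dotp u (moreau_grad k v) + `|u| ^+ 2).
  by rewrite mulr_ge0// ltW.
by rewrite /prox_at in h *; lra.
Qed.

(* Decreasing the parameter from [k] to [k'] raises the envelope by at most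
   [(k - k') / 2] times the squared norm of its gradient. *)
Lemma moreau_step k k' v v' u' : 0 < k' -> k' <= k -> dom_subdiff g v ->
  subdiff g v' u' ->
  moreau k' v' <= moreau k v + dotp (moreau_grad k v) (v' - v)
    + (2 * k)^-1 * `|v' - v| ^+ 2 + (k - k') / 2 * `|u'| ^+ 2.
Proof.
move=> k'0 kk gv uv'; have k0 : 0 < k by exact: lt_le_trans kk.
have gv' : dom_subdiff g v' by exists u'.
have [dy sy] := prox_subgradient gG k0 gv.
have := moreau_grad_le k'0 gv' dy; rewrite -/(prox_at k v).
have nle := moreau_grad_norm k'0 gv' uv'.
rewrite !moreauE//.
have E := sub_prox_at v k0; have E' := sub_prox_at v' k'0.
have -> : prox_at k v - prox_at k' v' = (v - v') - k *: moreau_grad k v + k' *: moreau_grad k' v'.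
  by rewrite -E -E'; apply: dotp_inj => w; rewrite !dotpE; ring.
rewrite -(opprB v' v).
set a := moreau_grad k v; set c := moreau_grad k' v' in nle *; set d := v' - v.
clearbody a c d.
rewrite !dotpDr !dotpNr !dotpZr dotpp => h.
(* The slack of the claim over the subgradient inequality [h] is [k / 2] times this square plus
   [(k - k') / 2 * (|u'|^2 - |c|^2)]. *)
have h2 := sqr_ge0 `|k^-1 *: d + a - c|.
have : 0 <= k / 2 * `|k^-1 *: d + a - c| ^+ 2 by rewrite mulr_ge0// divr_ge0// ltW.
rewrite sqr_normB sqr_normD sqr_normZ dotpDl !dotpZl.
have -> : k / 2 * (k^-1 ^+ 2 * `|d| ^+ 2 + 2 * (k^-1 * dotp d a) + `|a| ^+ 2 -
   2 * (k^-1 * dotp d c + dotp a c) + `|c| ^+ 2) =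
   (2 * k)^-1 * `|d| ^+ 2 + dotp d a + k / 2 * `|a| ^+ 2 - dotp d c - k * dotp a c + k / 2 * `|c| ^+ 2.
  by field; rewrite gt_eqF.
have : (k - k') / 2 * `|c| ^+ 2 <= (k - k') / 2 * `|u'| ^+ 2.
  by rewrite ler_wpM2l// ?ler_sqr ?nnegrE// divr_ge0// subr_ge0.
by move: h; rewrite (dotpC a d) (dotpC c d) (dotpC c a); lra.
Qed.

End moreau.

(** * Summable sequences *)

Section psummable.
Context {R : realType}.
Implicit Types u v w g : nat -> R.

(** Summability is kept as a bound on partial sums, the form in which descent estimates produce it.
    The sum [series u n] stops at index [n - 1], so that the weight [Gam k] of the theorem is
    [series gamma k.+1]. *)
Definition psummable u := (forall k, 0 <= u k) /\ exists B, forall n, series u n <= B.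

Definition unbounded_series u := forall B, exists n, B < series u n.

Lemma series0 u : series u 0 = 0.
Proof. by rewrite /series /= big_geq. Qed.

Lemma series_nondec u : (forall k, 0 <= u k) -> {homo series u : m n / (m <= n)%N >-> m <= n}.
Proof.
move=> u0; apply: homo_leq => [//|a b c|n]; first exact: le_trans.
by rewrite seriesSr lerDl.
Qed.

Lemma series_ge0 u n : (forall k, 0 <= u k) -> 0 <= series u n.
Proof. by move=> u0; rewrite -(series0 u) series_nondec. Qed.

Lemma ell1_plus_psummable u : ell1_plus u -> psummable u.
Proof.
move=> [u0 uc]; split=> //; exists (limn (series u)) => n.
have uE : (fun k => `|u k|) = u by apply/funext => k; rewrite ger0_norm.
rewrite /ell1 uE in uc.
by apply: nondecreasing_cvgn_le => //; exact: series_nondec.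
Qed.

Lemma psummable_cvg u : psummable u -> cvgn (series u).
Proof.
move=> [u0 [B uB]]; apply: nondecreasing_is_cvgn; first exact: series_nondec.
by exists B => _ [n _ <-].
Qed.

Lemma notin_ell1_unbounded u : (forall k, 0 <= u k) -> ~ ell1 u -> unbounded_series u.
Proof.
move=> u0 nu B; apply: contrapT => h; apply: nu; rewrite /ell1.
have -> : (fun k => `|u k|) = u by apply/funext => k; rewrite ger0_norm.
apply: psummable_cvg; split=> //; exists B => n.
by rewrite leNgt; apply/negP => Bn; apply: h; exists n.
Qed.

Lemma series_le u v n : (forall k, u k <= v k) -> series u n <= series v n.
Proof. by move=> uv; elim: n => [|n IH]; rewrite ?series0// !seriesSr lerD. Qed.

Lemma psummable_le u v : (forall k, 0 <= u k) -> (forall k, u k <= v k) ->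
  psummable v -> psummable u.
Proof.
move=> u0 uv [v0 [B vB]]; split=> //; exists B => n.
exact: le_trans (series_le _ uv) _.
Qed.

Lemma series_add u v n : series (fun k => u k + v k) n = series u n + series v n.
Proof. by elim: n => [|n IH]; rewrite ?series0 ?addr0// !seriesSr IH; ring. Qed.

Lemma series_scale (a : R) u n : series (fun k => a * u k) n = a * series u n.
Proof. by elim: n => [|n IH]; rewrite ?series0 ?mulr0// !seriesSr IH; ring. Qed.

Lemma psummableD u v : psummable u -> psummable v -> psummable (fun k => u k + v k).
Proof.
move=> [u0 [B uB]] [v0 [B' vB]]; split; first by move=> k; rewrite addr_ge0.
by exists (B + B') => n; rewrite series_add lerD.
Qed.

Lemma psummableZ (a : R) u : 0 <= a -> psummable u -> psummable (fun k => a * u k).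
Proof.
move=> a0 [u0 [B uB]]; split; first by move=> k; rewrite mulr_ge0.
by exists (a * B) => n; rewrite series_scale ler_wpM2l.
Qed.

Lemma psummable_telescope u (B : R) : (forall k, u k <= u k.+1) ->
  (forall k, u k <= B) -> psummable (fun k => u k.+1 - u k).
Proof.
move=> ui uB; split; first by move=> k; rewrite subr_ge0.
exists (B - u 0%N) => n; suff -> : series (fun k => u k.+1 - u k) n = u n - u 0%N.
  by rewrite lerB.
by elim: n => [|n IH]; rewrite ?series0 ?subrr// seriesSr IH; ring.
Qed.

Lemma psummable_cvg0 u : psummable u -> u @ \oo --> (0 : R).
Proof. by move=> /psummable_cvg; exact: cvg_series_cvg_0. Qed.

Lemma cvg0_dominated u v : (forall k, `|u k| <= v k) -> v @ \oo --> (0 : R) ->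
  u @ \oo --> (0 : R).
Proof.
move=> uv /cvgrPdist_le v0; apply/cvgrPdist_le => e /v0; apply: filterS => k.
rewrite !sub0r !normrN; apply: le_trans; apply: le_trans (uv k) _; exact: ler_norm.
Qed.

Lemma psummable_tail u (e : R) : psummable u -> 0 < e ->
  exists N, forall m n, (N <= m)%N -> (m <= n)%N -> series u n - series u m <= e.
Proof.
move=> su e0; have uc := psummable_cvg su; have [u0 _] := su.
have ule n : series u n <= limn (series u).
  by apply: nondecreasing_cvgn_le => //; exact: series_nondec.
have /cvgrPdist_le /(_ _ e0) [N _ hN] := uc.
exists N => m n Nm mn; have := hN m Nm; rewrite /= ler_norml => /andP[_ h].
by have := ule n; lra.
Qed.

(* Robbins-Siegmund: the product of the [1 + eta k] is bounded. *)
Lemma quasi_descent r g (eta sigma : nat -> R) : (forall k, 0 <= r k) ->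
  (forall k, 0 <= g k) -> psummable eta -> psummable sigma ->
  (forall k, r k.+1 + g k <= (1 + eta k) * r k + sigma k) ->
  [/\ exists B, forall k, r k <= B, psummable g & cvgn r].
Proof.
move=> r0 g0 [eta0 [Be etaB]] [sigma0 [Bs sigmaB]] h.
have rle k : r k <= (r 0%N + series sigma k) * expR (series eta k).
  elim: k => [|k IH]; first by rewrite !series0 expR0 addr0 mulr1.
  rewrite !seriesSr expRD.
  have h1 := expR_ge1Dx (eta k).
  have h2 : 1 <= expR (series eta k) by rewrite -expR0 ler_expR series_ge0.
  have h3 := h k; have h4 := g0 k; have h5 := r0 k.
  have h6 : (1 + eta k) * r k <= expR (eta k) * r k by rewrite ler_wpM2r.
  have h7 : expR (eta k) * r k <= expR (eta k) * ((r 0%N + series sigma k) * expR (series eta k)).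
    by rewrite ler_wpM2l// expR_ge0.
  have h8 : 1 <= expR (series eta k) * expR (eta k).
    rewrite -[X in X <= _]mulr1 ler_pM//.
    by apply: le_trans h1; rewrite lerDl.
  have h9 : sigma k * 1 <= sigma k * (expR (series eta k) * expR (eta k)).
    by rewrite ler_wpM2l.
  lra.
pose B := (r 0%N + Bs) * expR Be.
have rB k : r k <= B.
  rewrite (le_trans (rle k))// ler_pM ?expR_ge0//.
  - by rewrite addr_ge0// series_ge0.
  - by rewrite lerD2l.
  - by rewrite ler_expR.
(* Once [r] is bounded by [B], the multiplicative error becomes an additive summable one. *)
pose s k := B * eta k + sigma k.
have B0 : 0 <= B by exact: le_trans (r0 0%N) (rB _).
have ss : psummable s.
  by apply: psummableD; [apply: psummableZ => //; split=> //; exists Be|split=> //; exists Bs].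
have step k : r k.+1 + g k <= r k + s k.
  rewrite (le_trans (h k))// /s mulrDl mul1r addrA lerD2r lerD2l mulrC ler_wpM2r//.
have tele k : r k + series g k <= r 0%N + series s k.
  elim: k => [|k IH]; first by rewrite !series0.
  by rewrite !seriesSr; have := step k; lra.
have sg : psummable g.
  split=> //; have [_ [Bb sB]] := ss; exists (r 0%N + Bb) => n.
  by have := tele n; have := r0 n; have := sB n; lra.
split; [by exists B|exact: sg|].
pose t k := r k + series g k - series s k.
have tc : cvgn t.
  apply: nonincreasing_is_cvgn.
    apply/nonincreasing_seqP => k; rewrite /t !seriesSr; have := step k; lra.
  have [_ [Bb sB]] := ss; exists (- Bb) => _ [n _ <-].
  rewrite /t; have := r0 n; have := series_ge0 n g0; have := sB n; lra.
have -> : r = (fun k => t k - series g k + series s k).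
  by apply/funext => k; rewrite /t; ring.
apply: is_cvgD; last exact: psummable_cvg.
by apply: is_cvgB => //; exact: psummable_cvg.
Qed.

(** Divergence of the series of [g] brings [w] below [e / 2] at arbitrarily late indices. It cannot
    climb back to [e]: while [w n >= e / 2], an increase [c * g n] is at most [2 c / e] times
    [g n * w n], whose tail is small; and from below [e / 2] a single step adds little. *)
Lemma psummable_weight_cvg0 w g (c : R) : 0 <= c -> (forall k, 0 <= w k) ->
  (forall k, 0 <= g k) -> g @ \oo --> (0 : R) -> psummable (fun k => g k * w k) ->
  unbounded_series g -> (forall k, w k.+1 <= w k + c * g k) ->
  w @ \oo --> (0 : R).
Proof.
move=> c0 w0 g0 gc sgw gu wstep; apply/cvgrPdist_le => e e0.
pose c1 := c + 1; have c10 : 0 < c1 by rewrite ltr_wpDl.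
(* Chosen so that one step adds at most [e / 8] and the tail accounts for at most [e / 4]. *)
have d0 : 0 < e / (8 * c1) by rewrite divr_gt0// mulr_gt0.
have [N1 hN1] := psummable_tail sgw (mulr_gt0 e0 d0).
have /cvgrPdist_le /(_ _ d0) [N2 _ hN2] := gc.
pose N := maxn N1 N2.
have [M NM wM] : exists2 M, (N <= M)%N & w M <= e / 2.
  apply: contrapT => hn.
  have wbig n : (N <= n)%N -> e / 2 <= w n.
    move=> Nn; rewrite leNgt; apply/negP => h; apply: hn; exists n => //; exact: ltW.
  have gs n : (N <= n)%N -> e / 2 * (series g n - series g N) <=
      series (fun k => g k * w k) n - series (fun k => g k * w k) N.
    elim: n => [|n IH]; first by rewrite leqn0 => /eqP ->; rewrite !subrr mulr0.
    rewrite leq_eqVlt => /orP[/eqP <-|]; first by rewrite !subrr mulr0.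
    rewrite ltnS => Nn; rewrite !seriesSr; have := IH Nn.
    have : e / 2 * g n <= g n * w n by rewrite mulrC ler_wpM2l// wbig.
    lra.
  have [n hn1] := gu (series g N + 2 * (e / (8 * c1))).
  have Nn : (N <= n)%N.
    rewrite leqNgt; apply/negP => /ltnW nN.
    by have := series_nondec g0 nN; lra.
  have := gs _ Nn; have := hN1 N n (leq_maxl _ _) Nn.
  have : e / 2 * (2 * (e / (8 * c1))) < e / 2 * (series g n - series g N).
    by rewrite ltr_pM2l ?divr_gt0//; lra.
  lra.
have inv n : (M <= n)%N -> w n <= e / 2 + c1 * (e / (8 * c1)) +
    2 * c1 / e * (series (fun k => g k * w k) n - series (fun k => g k * w k) M).
  elim: n => [|n IH].
    by rewrite leqn0 => /eqP M0; subst M; rewrite subrr mulr0 addr0; nra.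
  rewrite leq_eqVlt => /orP[/eqP <-|].
    by rewrite subrr mulr0 addr0 (le_trans wM)// lerDl mulr_ge0// ltW.
  rewrite ltnS => Mn; rewrite seriesSr; have {}IH := IH Mn.
  have cg : c * g n <= c1 * g n by rewrite ler_wpM2r// lerDl.
  have gs : series (fun k => g k * w k) M <= series (fun k => g k * w k) n.
    by apply: series_nondec => // k; rewrite mulr_ge0.
  have K0 : 0 < 2 * c1 / e by rewrite divr_gt0// mulr_gt0.
  have Ks : 0 <= 2 * c1 / e * (series (fun k => g k * w k) n - series (fun k => g k * w k) M).
    by rewrite mulr_ge0 ?(ltW K0)// subr_ge0.
  have [wn|wn] := leP (e / 2) (w n).
    have : c1 * g n <= 2 * c1 / e * (g n * w n).
      have -> : 2 * c1 / e * (g n * w n) = c1 * g n * (2 / e * w n) by field; rewrite gt_eqF.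
      rewrite ler_peMr ?mulr_ge0// ?(ltW c10)//.
      rewrite -ler_pdivrMl ?divr_gt0// invf_div mulr1; lra.
    have := wstep n; lra.
  have gn : g n <= e / (8 * c1).
    have := hN2 n (leq_trans (leq_trans (leq_maxr _ _) NM) Mn).
    by rewrite /= sub0r normrN ger0_norm.
  have : c1 * g n <= c1 * (e / (8 * c1)) by rewrite ler_pM2l.
  have : 0 <= 2 * c1 / e * (g n * w n) by rewrite mulr_ge0 ?(ltW K0)// mulr_ge0.
  have := wstep n; lra.
exists M => // n /= Mn; rewrite sub0r normrN ger0_norm//.
rewrite (le_trans (inv _ Mn))//.
have h1 := hN1 M n (leq_trans (leq_maxl _ _) NM) Mn.
have : 2 * c1 / e * (series (fun k => g k * w k) n - series (fun k => g k * w k) M) <= 2 * c1 / e * (e * (e / (8 * c1))).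
  by rewrite ler_wpM2l// ltW// divr_gt0// mulr_gt0.
have -> : 2 * c1 / e * (e * (e / (8 * c1))) = e / 4 by field; rewrite !gt_eqF.
have -> : c1 * (e / (8 * c1)) = e / 8 by field; rewrite !gt_eqF.
lra.
Qed.

(** After subtraction of [e / 4] and of the partial sums of [sigma], the sequence obeys
    [y n.+1 <= (1 - g n) * y n]. The product of the factors is avoided: since
    [(1 - g) (1 + S + g) <= 1 + S], positive values of [y n] decay like the inverse of the series of
    [g]. Nothing bounds [q] from below, so the conclusion is one-sided. *)
Lemma contraction_le_eps q g (delta sigma : nat -> R) :
  (forall k, 0 < g k <= 1) -> unbounded_series g -> delta @ \oo --> (0 : R) ->
  psummable sigma ->
  (forall k, q k.+1 <= (1 - g k) * q k + g k * delta k + sigma k) ->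
  forall e, 0 < e -> \forall k \near \oo, q k <= e.
Proof.
move=> g01 gu dc ss qstep e e0.
have g0 k : 0 <= g k by have /andP[/ltW] := g01 k.
have e4 : 0 < e / 4 by rewrite divr_gt0.
have [N1 hN1] := psummable_tail ss e4.
have /cvgrPdist_le /(_ _ e4) [N2 _ hN2] := dc.
pose N := maxn N1 N2.
pose y k := q k - e / 4 - (series sigma k - series sigma N).
pose Y := `|y N|.
have sN n : (N <= n)%N -> 0 <= series sigma n - series sigma N.
  by move=> Nn; rewrite subr_ge0; apply: series_nondec => //; case: ss.
have inv n : (N <= n)%N -> y n * (1 + (series g n - series g N)) <= Y.
  elim: n => [|n IH].
    by rewrite leqn0 => /eqP N0; rewrite /Y N0 subrr addr0 mulr1 ler_norm.
  rewrite leq_eqVlt => /orP[/eqP <-|]; first by rewrite subrr addr0 mulr1 ler_norm.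
  rewrite ltnS => Nn; have {}IH := IH Nn.
  have dn : delta n <= e / 4.
    have := hN2 n (leq_trans (leq_maxr _ _) Nn).
    by rewrite /= sub0r normrN; exact: le_trans (ler_norm _).
  have gd : g n * delta n <= g n * (e / 4) by rewrite ler_wpM2l.
  have gsn : 0 <= series g n - series g N by rewrite subr_ge0 series_nondec.
  have /andP[gn0 gn1] := g01 n.
  have ystep : y n.+1 <= (1 - g n) * y n.
    rewrite /y seriesSr; have := qstep n.
    have : 0 <= g n * (series sigma n - series sigma N) by rewrite mulr_ge0// sN.
    lra.
  rewrite seriesSr; set S := series g n - series g N in IH gsn *.
  rewrite (_ : series g n + g n - series g N = S + g n); last by rewrite /S; ring.
  have [yn|yn] := leP (y n) 0.
    have : (1 - g n) * y n <= 0 by rewrite mulr_ge0_le0// subr_ge0.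
    move=> h; rewrite (@le_trans _ _ 0)// ?normr_ge0//.
    by rewrite mulr_le0_ge0//; lra.
  rewrite (@le_trans _ _ ((1 - g n) * y n * (1 + (S + g n))))//.
    by rewrite ler_wpM2r//; lra.
  rewrite (le_trans _ IH)//.
  have -> : (1 - g n) * y n * (1 + (S + g n)) = y n * (1 + S) - y n * (g n * (S + g n)) by ring.
  by rewrite gerBl mulr_ge0 ?(ltW yn)// mulr_ge0// addr_ge0.
have [M hM] := gu (series g N + Y / (e / 4)).
exists (maxn N M) => // n /= nNM.
have Nn : (N <= n)%N by exact: leq_trans (leq_maxl _ _) nNM.
have := series_nondec g0 (leq_trans (leq_maxr _ _) nNM : (M <= n)%N).
have := hN1 N n (leq_maxl _ _) Nn; have := inv _ Nn.
move=> h1 h2 h3.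
have [yn|yn] := leP (y n) (e / 4); first by rewrite /y in yn; lra.
have : Y / (e / 4) * (e / 4) = Y by rewrite divfK// gt_eqF.
have : e / 4 * (1 + (series g n - series g N)) <= y n * (1 + (series g n - series g N)).
  apply: ler_wpM2r; last exact: ltW.
  by rewrite addr_ge0// subr_ge0 series_nondec.
have : Y / (e / 4) * (e / 4) < (series g n - series g N) * (e / 4).
  by rewrite ltr_pM2r//; lra.
lra.
Qed.

(* Abel-Dini: [g k / series g k.+1] is not summable. *)
Lemma frequently_le_inv_series w g : (forall k, 0 < g k) -> unbounded_series g ->
  (forall k, 0 <= w k) -> psummable (fun k => g k * w k) ->
  forall N, exists2 k, (N <= k)%N & w k <= (series g k.+1)^-1.
Proof.
move=> g0 gu w0 sgw N; apply: contrapT => hn.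
have g0' k : 0 <= g k by exact: ltW.
have sg k : 0 < series g k.+1 by rewrite seriesSr ltr_wpDl// series_ge0.
have wbig n : (N <= n)%N -> (series g n.+1)^-1 <= w n.
  move=> Nn; rewrite leNgt; apply/negP => h; apply: hn; exists n => //; exact: ltW.
have [N1 hN1] := psummable_tail sgw (ltac:(by []) : (0 : R) < 2^-1).
pose M := maxn N N1.
(* All terms are compared with the common denominator [series g m.+1]; for large [n = m.+1] the left
   side exceeds the tail bound [1 / 2]. *)
have key n m : (M <= n)%N -> (n <= m.+1)%N -> (series g n - series g M) / series g m.+1 <=
    series (fun k => g k * w k) n - series (fun k => g k * w k) M.
  elim: n => [|n IH]; first by rewrite leqn0 => /eqP ->; rewrite !subrr mul0r.
  rewrite leq_eqVlt => /orP[/eqP <-|]; first by rewrite !subrr mul0r.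
  rewrite ltnS => Mn nm; rewrite (seriesSr g n) (seriesSr _ n).
  have h1 := IH Mn (ltnW nm).
  have h2 : g n / series g m.+1 <= g n * w n.
    rewrite ler_pM2l// (le_trans _ (wbig n (leq_trans (leq_maxl _ _) Mn)))//.
    by rewrite lef_pV2 ?posrE// series_nondec.
  lra.
have [n hn1] := gu (2 * series g M.+1).
have Mn : (M < n)%N.
  rewrite ltnNge; apply/negP => nM.
  have := series_nondec g0' (leq_trans nM (leqnSn M)); have := sg M; lra.
case: n hn1 Mn => // n hn1; rewrite ltnS => Mn.
have Mn1 : (M <= n.+1)%N by exact: leqW.
have h1 := key n.+1 n Mn1 (leqnn _).
have h2 := hN1 M n.+1 (leq_maxr _ _) Mn1.
have := le_trans h1 h2; rewrite ler_pdivrMr// => h3.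
have := series_nondec g0' (leqnSn M); lra.
Qed.

Lemma subsequence_of_frequently (P : nat -> Prop) :
  (forall N, exists2 k, (N <= k)%N & P k) ->
  exists2 phi : nat -> nat, {homo phi : i j / (i < j)%N} & forall j, P (phi j).
Proof.
move=> h; have /choice[f fP] : forall N, exists k, (N <= k)%N /\ P k.
  by move=> N; have [k Nk Pk] := h N; exists k.
exists (fix phi n := if n is n'.+1 then f (phi n').+1 else f 0%N).
  apply: homo_ltn; first by move=> a b c; exact: ltn_trans.
  by move=> n; have [] := fP ((fix phi n := if n is n'.+1 then f (phi n').+1 else f 0%N) n).+1.
by case => [|j]; [have [] := fP 0%N|have [] := fP ((fix phi n := if n is n'.+1 then f (phi n').+1 else f 0%N) j).+1].
Qed.

End psummable.

(** * Opial's lemma *)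

Section opial.
Context {R : realType} {H : hilbertType R}.
Implicit Types (u : nat -> H).

Definition weak_limit_along (U : set_system nat) u (m : H) :=
  forall w, dotp (u k) w @[k --> U] --> dotp m w.

(** Along an ultrafilter every bounded real sequence converges, so the limits of all pairings exist
    at once and form a bounded linear functional of [w]. This replaces a diagonal extraction and
    needs no separability. *)
Lemma bounded_ultra_weak_limit u (B : R) (U : set_system nat) : UltraFilter U ->
  (forall k, `|u k| <= B) -> exists m, weak_limit_along U u m.
Proof.
move=> UU uB; have PU := @ultra_proper _ _ UU.
have h (w : H) : exists l : R, dotp (u k) w @[k --> U] --> l.
  have [|l [_ ul]] := @segment_compact R (- (B * `|w|)) (B * `|w|)
      (dotp (u k) w @[k --> U]) _.
    suff : U [set k | dotp (u k) w \in `[- (B * `|w|), B * `|w|]] by [].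
    apply: filterE => k /=; rewrite in_itv /= -ler_norml.
    by rewrite (le_trans (norm_dotp_le _ _))// ler_wpM2r.
  exists l => V Vl; have [//|nV] := in_ultra_setVsetC ((fun k => dotp (u k) w) @^-1` V) UU.
  by have [t [nVt Vt]] := ul (~` V) V nV Vl.
have /choice[l hl] := h.
have lbd w : `|l w| <= B * `|w|.
  have /cvg_norm/cvgr_to_le := hl w; apply; apply: filterE => k.
  by rewrite (le_trans (norm_dotp_le _ _))// ler_wpM2r.
have [||m hm] := riesz _ _ lbd.
- move=> a c; apply: (cvg_unique (@norm_hausdorff _ _) (hl (a + c))).
  rewrite (_ : (fun k => dotp (u k) (a + c)) = (fun k => dotp (u k) a + dotp (u k) c)).
    exact: cvgD (hl a) (hl c).
  by apply/funext => k; rewrite dotpDr.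
- move=> a c; apply: (cvg_unique (@norm_hausdorff _ _) (hl (a *: c))).
  rewrite (_ : (fun k => dotp (u k) (a *: c)) = (fun k => a * dotp (u k) c)).
    exact: cvgMr (hl c).
  by apply/funext => k; rewrite dotpZr.
by exists m => w; rewrite -hm.
Qed.

(* Opial's lemma, with cluster points expressed through ultrafilters. *)
Lemma opial u (S : set H) (B : R) : (forall k, `|u k| <= B) ->
  (forall m, S m -> cvg (`|u k - m| ^+ 2 @[k --> \oo])) ->
  (forall (U : set_system nat) m, ProperFilter U -> U --> \oo -> weak_limit_along U u m -> S m) ->
  exists2 m, S m & weak_limit_along \oo u m.
Proof.
move=> uB Scvg Scl.
have lim_uniq U U' m m' : ProperFilter U -> ProperFilter U' -> U --> \oo -> U' --> \oo ->
    weak_limit_along U u m -> weak_limit_along U' u m' -> m = m'.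
  move=> PU PU' Uoo U'oo um um'.
  have Sm := Scl _ _ PU Uoo um; have Sm' := Scl _ _ PU' U'oo um'.
  (* By polarization this pairing is half a difference of two convergent squared distances plus a
     constant. It therefore converges along the whole sequence, and both limits see the same
     value. *)
  have : cvg (dotp (u k) (m - m') @[k --> \oo]).
    rewrite (_ : (fun k => dotp (u k) (m - m')) = (fun k => 2^-1 * ((`|u k - m'| ^+ 2 - `|u k - m| ^+ 2) + (`|m| ^+ 2 - `|m'| ^+ 2)))).
      apply: is_cvgMr; apply: is_cvgD; last exact: is_cvg_cst.
      by apply: is_cvgB; exact: Scvg.
    by apply/funext => k; rewrite !sqr_normB dotpBr; field.
  set l := lim _ => hl.
  have h1 : dotp m (m - m') = l.
    apply: (cvg_unique (@norm_hausdorff _ _) (um (m - m'))).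
    by apply: cvg_trans hl; exact: cvg_app.
  have h2 : dotp m' (m - m') = l.
    apply: (cvg_unique (@norm_hausdorff _ _) (um' (m - m'))).
    by apply: cvg_trans hl; exact: cvg_app.
  apply/eqP; rewrite -subr_eq0 -normr_eq0 -sqrf_eq0 -dotpp dotpBl h1 h2 subrr//.
have [U [UU ooU]] := ultraFilterLemma (eventually_filter).
have PU := @ultra_proper _ _ UU.
have [m um] := bounded_ultra_weak_limit UU uB.
exists m; first exact: (Scl U).
move=> w; apply/cvgrPdist_lt => e e0; apply: contrapT => hn.
(* If convergence failed against [w], the indices in [Bd] would be frequent. An ultrafilter on them
   yields a weak limit, equal to [m] by uniqueness, yet kept at distance [e] from it. *)
pose Bd := [set k | e <= `|dotp m w - dotp (u k) w|].
have PG : ProperFilter (within Bd \oo).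
  apply: Build_ProperFilter_ex => V VG.
  have {}VG : \forall k \near \oo, Bd k -> V k by exact: VG.
  apply: contrapT => V0; apply: hn; apply: filterS VG => k kV /=.
  rewrite ltNge; apply/negP => ke; apply: V0; exists k; exact: kV.
have [U' [UU' GU']] := ultraFilterLemma PG.
have PU' := @ultra_proper _ _ UU'.
have U'oo : U' --> \oo.
  by move=> V Voo; apply: GU'; apply: filterS Voo => k Vk _.
have [m' um'] := bounded_ultra_weak_limit UU' uB.
have mm' : m = m' by exact: (lim_uniq U U').
have U'Bd : U' Bd.
  by apply: GU'; exact: (@filterE nat \oo _ (fun k => Bd k -> Bd k)).
have /cvgrPdist_lt /(_ _ e0) h := um' w.
have [k [/= k1 k2]] := filter_ex (filterI U'Bd h).
by move: k2; rewrite -mm' ltNge k1.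
Qed.

End opial.

(** * Inexact descent with a dual update *)

Lemma psummable_shift (R : realType) (u : nat -> R) : 0 <= u 0%N ->
  psummable (fun k => u k.+1) -> psummable u.
Proof.
move=> u00 [u0 [B uB]]; split; first by case.
have uS n : series u n.+1 = u 0%N + series (fun k => u k.+1) n.
  elim: n => [|n IH]; first by rewrite seriesSr !series0 add0r addr0.
  by rewrite seriesSr IH (seriesSr _ n) addrA.
exists (u 0%N + B) => -[|n]; last by rewrite uS lerD2l.
by rewrite series0 addr_ge0//; have := uB 0%N; rewrite series0.
Qed.

Lemma sqr_norm_conv (R : realType) (H : hilbertType R) (u v : H) (t : R) :
  0 <= t <= 1 -> `|(1 - t) *: u + t *: v| ^+ 2 <= (1 - t) * `|u| ^+ 2 + t * `|v| ^+ 2.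
Proof.
move=> /andP[t0 t1]; rewrite sqr_normD !sqr_normZ dotpZl dotpZr.
have h := sqr_ge0 `|u - v|; rewrite sqr_normB in h.
have : 0 <= t * (1 - t) * (`|u| ^+ 2 - 2 * dotp u v + `|v| ^+ 2).
  by rewrite mulr_ge0// mulr_ge0// subr_ge0.
lra.
Qed.

(** Real bookkeeping for one step: [a] is the smoothed Lagrangian gap, [p] the pairing of [mu - mus]
    with the residual, [E] and [n] the squared residual and dual distance; [q] pairs the old
    multiplier with the new residual. The bound [2 * th <= rlo * gam'] absorbs the dual ascent. *)
Lemma energy_descent_step (R : realType)
    (gam gam' rh rh' c th a a' p p' q E E' n n' eps rlo : R) :
  0 < c -> c * th = gam -> 0 <= th -> 0 <= gam <= 1 -> 2 * th <= rlo * gam' ->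
  0 <= gam' -> rlo <= rh -> rh <= rh' -> p' = q + th * E' ->
  n' = n + 2 * th * q + th ^+ 2 * E' -> 0 <= E' ->
  a' + q + rh / 2 * E' <=
    (1 - gam) * (a + p + rh / 2 * E) - gam * rh / 2 * E + eps ->
  (1 - gam') * (a' + p' + rh' / 2 * E') + c / 2 * n' - gam' * rh' / 2 * E'
    + gam * a' + rlo / 2 * gam * E' <=
  (1 - gam) * (a + p + rh / 2 * E) + c / 2 * n - gam * rh / 2 * E
    + (gam - gam') * (a' + p' + rh' / 2 * E') + (rh' - rh) / 2 * E' + eps.
Proof.
move=> c0 cth th0 /andP[gam0 gam1] th2 gam'0 rlorh rhrh' -> -> E'0 h.
have -> : c / 2 * (n + 2 * th * q + th ^+ 2 * E') =
  c / 2 * n + gam * q + gam * th / 2 * E' by rewrite -cth; field.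
have h1 : 0 <= (rlo * gam' - 2 * th) * E' by rewrite mulr_ge0// subr_ge0.
have h2 : 0 <= gam' * (rh' - rlo) * E' by rewrite mulr_ge0// mulr_ge0//; lra.
have h3 : 0 <= gam * (rh - rlo) * E' by rewrite mulr_ge0// mulr_ge0//; lra.
have h4 : 0 <= gam * th * E' by rewrite mulr_ge0// mulr_ge0.
have h5 : 0 <= gam * (rh' - rh) * E' by rewrite mulr_ge0// mulr_ge0//; lra.
lra.
Qed.

Section inexact_descent.
Context {R : realType} {Hp Hd : hilbertType R}.
Variables (A : {linear Hp -> Hd}) (b : Hd) (C : set Hp) (P : Hp -> R).
Variables (Phi gamma beta rho eps : nat -> R) (c Mhi rlo rhi M D BP : R).
Variables (x s : nat -> Hp) (mu : nat -> Hd).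

Let e k := A (x k) - b.
Let E k := `|e k| ^+ 2.

Hypotheses (Cconv : forall u v t, 0 < t < 1 -> C u -> C v ->
    C (t *: u + (1 - t) *: v))
  (Pconv : forall u v t, 0 < t < 1 -> C u -> C v ->
    P (t *: u + (1 - t) *: v) <= t * P u + (1 - t) * P v)
  (Pbd : forall u, C u -> `|P u| <= BP)
  (Abd : forall u, C u -> `|A u - b| <= D)
  (Cx : forall k, C (x k)) (Cs : forall k, C (s k))
  (xS : forall k, x k.+1 = x k + gamma k *: (s k - x k))
  (muS : forall k, mu k.+1 = mu k + (gamma k / c) *: e k.+1)
  (gamma01 : forall k, 0 < gamma k <= 1)
  (gamma_dec : forall k, gamma k.+1 <= gamma k)
  (gamma_ratio : forall k, gamma k <= Mhi * gamma k.+1)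
  (c0 : 0 < c) (rlo0 : 0 < rlo) (c_large : Mhi / c <= rlo / 2)
  (rho_bd : forall k, rlo <= rho k <= rhi)
  (rho_nd : forall k, rho k <= rho k.+1)
  (gamma_unb : unbounded_series gamma)
  (gamma_cvg0 : gamma @ \oo --> (0 : R))
  (gammabeta : psummable (fun k => gamma k * beta k))
  (eps_sum : psummable eps)
  (beta0 : forall k, 0 < beta k) (beta_dec : forall k, beta k.+1 <= beta k)
  (beta_cvg0 : beta @ \oo --> (0 : R)) (M0 : 0 <= M)
  (Phi_le : forall k, Phi k <= P (x k)) (le_Phi : forall k, P (x k) <= Phi k + beta k * M)
  (descent : forall k w, C w ->
    Phi k.+1 + dotp (mu k) (e k.+1) + rho k / 2 * E k.+1 <=
    (1 - gamma k) * (Phi k + dotp (mu k) (e k) + rho k / 2 * E k)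
    + gamma k * (P w + dotp (mu k) (A w - b) + rho k / 2 * `|A w - b| ^+ 2)
    - gamma k * rho k / 2 * `|A (x k - w)| ^+ 2 + eps k).

Section saddle_point.
Variables (xs : Hp) (mus : Hd).
Hypotheses (Cxs : C xs) (Axs : A xs = b)
  (saddle : forall w, C w -> P xs <= P w + dotp mus (A w - b)).

Let g0 k : 0 < gamma k. Proof. by have /andP[] := gamma01 k. Qed.
Let g0' k : 0 <= gamma k. Proof. exact: ltW. Qed.
Let g1 k : gamma k <= 1. Proof. by have /andP[] := gamma01 k. Qed.
Let r0 k : 0 < rho k. Proof. by have /andP[h _] := rho_bd k; exact: lt_le_trans h. Qed.
Let D0 : 0 <= D. Proof. exact: le_trans (Abd Cxs). Qed.
Let E0 k : 0 <= E k. Proof. exact: sqr_ge0. Qed.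
Let ED k : E k <= D ^+ 2.
Proof. by rewrite /E ler_sqr ?nnegrE ?D0// Abd. Qed.
Let rhi0 : 0 < rhi. Proof. by have /andP[_ h] := rho_bd 0%N; exact: lt_le_trans h. Qed.

Let gap k := P (x k) + dotp mus (e k) - P xs.
Let agap k := Phi k + dotp mus (e k) - P xs.
Let n k := `|mu k - mus| ^+ 2.
Let p k := dotp (mu k - mus) (e k).
(** The pairing with [mu k] is split: its [mus] part belongs to a gap bounded below up to
    [beta k * M], and the rest, [p k], is dominated by [E k] and [n k]. *)
Let V k := agap k + p k + rho k / 2 * E k.
Let r k := (1 - gamma k) * V k + c / 2 * n k - gamma k * rho k / 2 * E k.

Let gap_ge0 k : 0 <= gap k.
Proof. by rewrite /gap subr_ge0; exact: saddle. Qed.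

Let gap_agap k : gap k <= agap k + beta k * M.
Proof. by rewrite /gap /agap; have := le_Phi k; lra. Qed.

Let agap_gap k : agap k <= gap k.
Proof. by rewrite /gap /agap; have := Phi_le k; lra. Qed.

Let gap_bd u : C u -> P u + dotp mus (A u - b) - P xs <= 2 * BP + `|mus| * D.
Proof.
move=> Cu; have := Pbd Cu; have := Pbd Cxs; rewrite !ler_norml.
have : dotp mus (A u - b) <= `|mus| * D.
  by rewrite (le_trans (dotp_le_norm _ _))// ler_wpM2l// Abd.
by move=> ? /andP[? ?] /andP[? ?]; lra.
Qed.

(** Young's inequality, weighted so that half of the term [c / 2 * n] of the energy survives. *)
Let p_bd k : `|p k| <= E k / c + c / 4 * n k.
Proof.
have h : 0 <= c / 4 * (`|mu k - mus| - 2 / c * `|e k|) ^+ 2.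
  by rewrite mulr_ge0 ?sqr_ge0// divr_ge0// ltW.
rewrite (le_trans (norm_dotp_le _ _))// -subr_ge0 (le_trans h)// /E /n.
by rewrite le_eqVlt; apply/orP; left; apply/eqP; field; rewrite gt_eqF.
Qed.

Let step k : r k.+1 + gamma k * agap k.+1 + rlo / 2 * gamma k * E k.+1 <=
  r k + (gamma k - gamma k.+1) * V k.+1 + (rho k.+1 - rho k) / 2 * E k.+1 + eps k.
Proof.
pose th := gamma k / c.
have cth : c * th = gamma k by rewrite /th mulrC divfK// gt_eqF.
have th0 : 0 <= th by rewrite divr_ge0// ltW.
have := descent k Cxs; rewrite Axs subrr dotp0r normr0 expr0n mulr0 !addr0.
rewrite linearB /= Axs -/(e k) -/(E k) => h.
apply: (@energy_descent_step _ _ _ _ _ _ th _ _ _ _ (dotp (mu k - mus) (e k.+1))) => //.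
- by rewrite ltW //= g1.
- rewrite /th.
  have h1 : gamma k / c <= Mhi * gamma k.+1 / c by rewrite ler_wpM2r// invr_ge0 ltW.
  have h2 : Mhi / c * gamma k.+1 <= rlo / 2 * gamma k.+1 by rewrite ler_wpM2r.
  lra.
- by have /andP[] := rho_bd k.
- by rewrite /p muS /th /E -dotpp !dotpE; ring.
- by rewrite /n muS (addrAC (mu k)) (sqr_normD (mu k - mus)) sqr_normZ dotpZr /E mulrA.
- rewrite /agap /p !dotpBl; lra.
Qed.

Let energy : [/\ exists B, forall k, n k <= B,
  psummable (fun k => gamma k * gap k.+1), psummable (fun k => gamma k * E k.+1)
  & cvgn r].
Proof.
(* [K0] makes [r + K0] dominate [c / 4 * n]: it collects the smoothing error, Young's remainder and
   the subtracted penalty. [K1] bounds [V k - c / 4 * n k] from above, and [K2] adds the cost of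
   replacing [n k.+1] by [2 * n k]. *)
pose K0 := beta 0%N * M + D ^+ 2 / c + rhi * D ^+ 2 / 2.
pose K1 := 2 * BP + `|mus| * D + D ^+ 2 / c + rhi * D ^+ 2 / 2.
pose K2 := K1 + D ^+ 2 / (2 * c).
have betale k : beta k <= beta 0%N.
  by elim: k => // k; exact: le_trans.
have BP0 : 0 <= BP by exact: le_trans (Pbd Cxs).
have K20 : 0 <= K2.
  by rewrite /K2 /K1 !addr_ge0// ?mulr_ge0// ?sqr_ge0// ?invr_ge0// ?mulr_ge0// ltW.
have E2c k : E k / c <= D ^+ 2 / c by rewrite ler_wpM2r// invr_ge0 ltW.
have rE k : 0 <= rho k / 2 * E k <= rhi * D ^+ 2 / 2.
  apply/andP; split; first by rewrite mulr_ge0// divr_ge0// ltW.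
  have /andP[_ h2] := rho_bd k.
  have h : rho k * E k <= rhi * D ^+ 2 by rewrite ler_pM// ltW.
  lra.
have Rn k : c / 4 * n k <= r k + K0.
  have := p_bd k; rewrite ler_norml => /andP[pl pu].
  have /andP[rE1 rE2] := rE k.
  have h1 : beta k * M <= beta 0%N * M by rewrite ler_wpM2r.
  have h2 : - (beta 0%N * M + D ^+ 2 / c + c / 4 * n k) <= V k.
    by rewrite /V; have := gap_agap k; have := gap_ge0 k; have := E2c k; lra.
  have h3 : - (beta 0%N * M + D ^+ 2 / c + c / 4 * n k) <= (1 - gamma k) * V k.
    have [V0|V0] := leP 0 (V k).
      have : 0 <= (1 - gamma k) * V k by rewrite mulr_ge0// subr_ge0.
      apply: le_trans; rewrite oppr_le0 !addr_ge0// ?mulr_ge0// ?sqr_ge0// ?invr_ge0 ?ltW//.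
    apply: le_trans h2 _; rewrite mulrBl mul1r lerDl oppr_ge0 mulr_ge0_le0// ltW//.
  have h4 : gamma k * rho k / 2 * E k <= rhi * D ^+ 2 / 2.
    apply: le_trans rE2; rewrite -!mulrA ler_piMl//; first by rewrite mulrA.
  by rewrite /r /K0; lra.
have Vn k : V k <= K1 + c / 4 * n k.
  have := p_bd k; rewrite ler_norml => /andP[pl pu].
  have /andP[rE1 rE2] := rE k.
  by rewrite /V /K1; have := agap_gap k; have := gap_bd (Cx k); have := E2c k; rewrite -/(e k) -/(gap k); lra.
have nS k : c / 4 * n k.+1 <= 2 * (c / 4 * n k) + D ^+ 2 / (2 * c).
  have h1 := sqr_ge0 `|(mu k - mus) - (gamma k / c) *: e k.+1|.
  have h2 : n k.+1 <= 2 * n k + 2 * (gamma k / c) ^+ 2 * E k.+1.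
    move: h1; rewrite /n /E muS (addrAC (mu k) _ (- mus)) (sqr_normD (mu k - mus) ((gamma k / c) *: e k.+1)) (sqr_normB (mu k - mus)) sqr_normZ; lra.
  have h3 : (gamma k / c) ^+ 2 * E k.+1 <= c^-1 ^+ 2 * D ^+ 2.
    rewrite ler_pM ?sqr_ge0// ler_sqr ?nnegrE ?invr_ge0 ?divr_ge0// ?(ltW c0)//.
    by rewrite ler_piMl// invr_ge0 ltW.
  have h4 : c / 4 * n k.+1 <= c / 4 * (2 * n k + 2 * (c^-1 ^+ 2 * D ^+ 2)).
    by rewrite ler_wpM2l// ?divr_ge0// ?(ltW c0)//; lra.
  apply: le_trans h4 _; rewrite le_eqVlt; apply/orP; left; apply/eqP; field.
  by rewrite gt_eqF.
pose sigma k := K2 * (gamma k - gamma k.+1) + M * (gamma k * beta k)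
   + D ^+ 2 / 2 * (rho k.+1 - rho k) + eps k.
have dgam : psummable (fun k => gamma k - gamma k.+1).
  have /= := @psummable_telescope _ (fun k => - gamma k) 0.
  under eq_fun do rewrite opprK addrC.
  apply => k; rewrite ?lerN2// oppr_le0//.
have ssig : psummable sigma.
  apply: psummableD => //; apply: psummableD; first apply: psummableD.
  - exact: psummableZ.
  - exact: psummableZ.
  - apply: psummableZ; first by rewrite divr_ge0// sqr_ge0.
    apply: (@psummable_telescope _ _ rhi) => // k; by have /andP[] := rho_bd k.
(* The smoothed gap may be negative; adding [beta k.+1 * M] repairs this at the summable cost
   [M * (gamma k * beta k)]. The multiplicative error [2 * (gamma k - gamma k.+1)] telescopes. *)
have [||||k|[B RB] sg rc] := @quasi_descent _ (fun k => r k + K0)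
    (fun k => gamma k * (agap k.+1 + beta k.+1 * M) + rlo / 2 * gamma k * E k.+1)
    (fun k => 2 * (gamma k - gamma k.+1)) sigma.
- by move=> k; apply: le_trans (Rn k); rewrite mulr_ge0 ?sqr_ge0// divr_ge0// ltW.
- move=> k; rewrite addr_ge0 ?mulr_ge0// ?divr_ge0// ?(ltW rlo0)//.
  exact: le_trans (gap_ge0 _) (gap_agap _).
- exact: psummableZ.
- exact: ssig.
- have h1 := step k.
  have h2 : (gamma k - gamma k.+1) * V k.+1 <= (gamma k - gamma k.+1) * (K2 + 2 * (r k + K0)).
    rewrite ler_wpM2l ?subr_ge0//.
    by have := Vn k.+1; have := nS k; have := Rn k; rewrite /K2; lra.
  have h3 : gamma k * (beta k.+1 * M) <= M * (gamma k * beta k).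
    have -> : M * (gamma k * beta k) = gamma k * (beta k * M) by ring.
    by rewrite ler_wpM2l// ler_wpM2r.
  have h4 : (rho k.+1 - rho k) / 2 * E k.+1 <= D ^+ 2 / 2 * (rho k.+1 - rho k).
    have : (rho k.+1 - rho k) / 2 * E k.+1 <= (rho k.+1 - rho k) / 2 * D ^+ 2.
      by rewrite ler_wpM2l// divr_ge0// subr_ge0.
    lra.
  by rewrite /sigma; lra.
split.
- exists (4 / c * B) => k; have h := le_trans (Rn k) (RB k).
  have : 4 / c * (c / 4 * n k) <= 4 / c * B by rewrite ler_wpM2l// divr_ge0// ltW.
  by rewrite mulrA (_ : 4 / c * (c / 4) = 1) ?mul1r//; field; rewrite gt_eqF.
- apply: psummable_le sg => k; first by rewrite mulr_ge0.
  rewrite -[leLHS]addr0 lerD ?ler_wpM2l// ?mulr_ge0// ?divr_ge0// ltW//.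
- have : psummable (fun k => 2 / rlo * (gamma k * (agap k.+1 + beta k.+1 * M) + rlo / 2 * gamma k * E k.+1)).
    by apply: psummableZ => //; rewrite divr_ge0// ltW.
  apply: psummable_le => k; first by rewrite mulr_ge0.
  have -> : gamma k * E k.+1 = 2 / rlo * (rlo / 2 * gamma k * E k.+1) by field; rewrite gt_eqF.
  rewrite ler_wpM2l ?divr_ge0// ?(ltW rlo0)// lerDr mulr_ge0//.
  exact: le_trans (gap_ge0 _) (gap_agap _).
- have -> : r = (fun k => (r k + K0) - K0) by apply/funext => k; rewrite addrK.
  by apply: is_cvgB => //; exact: is_cvg_cst.
Qed.


Let eS k : e k.+1 = (1 - gamma k) *: e k + gamma k *: (A (s k) - b).
Proof.
rewrite /e xS linearD linearZ linearB; apply: dotp_inj => w.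
by rewrite !dotpE; ring.
Qed.

Let E_cvg0 : E @ \oo --> (0 : R).
Proof.
have [_ _ sE _] := energy.
apply: (@psummable_weight_cvg0 _ E gamma (D ^+ 2)) => //; first exact: sqr_ge0.
  (* The energy sums [gamma k * E k.+1], which dominates [gamma k.+1 * E k.+1] as [gamma] is
     nonincreasing. *)
  apply: psummable_shift; first by rewrite mulr_ge0.
  by apply: psummable_le sE => k; rewrite ?mulr_ge0// ler_wpM2r.
move=> k; rewrite {1}/E eS.
apply: (le_trans (sqr_norm_conv _ _ _)); first by rewrite g0' g1.
have : gamma k * `|A (s k) - b| ^+ 2 <= gamma k * D ^+ 2.
  by rewrite ler_wpM2l// ler_sqr ?nnegrE// Abd.
have : 0 <= gamma k * E k by rewrite mulr_ge0.
rewrite -/(E k); lra.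
Qed.

Let gap_cvg0 : gap @ \oo --> (0 : R).
Proof.
have [_ sg _ _] := energy.
have BP0 : 0 <= BP by exact: le_trans (Pbd Cxs).
apply: (@psummable_weight_cvg0 _ gap gamma (2 * BP + `|mus| * D)) => //.
- by rewrite addr_ge0// mulr_ge0.
- apply: psummable_shift; first by rewrite mulr_ge0.
  by apply: psummable_le sg => k; rewrite ?mulr_ge0// ler_wpM2r.
move=> k; have hs := gap_bd (Cs k).
have hP : P (x k.+1) <= gamma k * P (s k) + (1 - gamma k) * P (x k).
  have -> : x k.+1 = gamma k *: s k + (1 - gamma k) *: x k.
    by rewrite xS; apply: dotp_inj => w; rewrite !dotpE; ring.
  (* The convexity hypothesis covers interior weights only, so a full step [gamma k = 1] is treated
     apart. *)
  have := g1 k; rewrite le_eqVlt => /orP[/eqP ->|g1k].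
    by rewrite subrr scale0r scale1r addr0 mul0r mul1r addr0.
  by apply: Pconv => //; rewrite g0.
have h : gamma k * (P (s k) + dotp mus (A (s k) - b) - P xs) <= gamma k * (2 * BP + `|mus| * D).
  by rewrite ler_wpM2l.
have h2 : 0 <= gamma k * gap k by rewrite mulr_ge0.
have hd : dotp mus (e k.+1) = (1 - gamma k) * dotp mus (e k) +
    gamma k * dotp mus (A (s k) - b) by rewrite eS dotpDr !dotpZr.
by move: h2; rewrite /gap hd; lra.
Qed.

Let e_cvg0 : (fun k => `|e k|) @ \oo --> (0 : R).
Proof.
have -> : (fun k => `|e k|) = (fun k => Num.sqrt (E k)).
  by apply/funext => k; rewrite /E sqrtr_sqr normr_id.
rewrite -[X in _ --> X](@sqrtr0 R); apply: continuous_cvg => //.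
exact: sqrt_continuous.
Qed.

(** The pairing [p] is a bounded multiplier against a vanishing residual. The limit also identifies
    [P xs] as the limit of the augmented Lagrangian at [x k]. *)
Let V_cvg0 : V @ \oo --> (0 : R).
Proof.
have [[B nB] _ _ _] := energy.
have p_le k : `|p k| <= Num.sqrt B * `|e k|.
  rewrite (le_trans (norm_dotp_le _ _))// ler_wpM2r//.
  by rewrite -[leLHS]normr_id -sqrtr_sqr ler_wsqrtr// nB.
apply: (@cvg0_dominated _ _ (fun k => gap k + beta k * M + Num.sqrt B * `|e k| + rhi / 2 * E k)).
  move=> k; have h1 : `|agap k| <= gap k + beta k * M.
    have := gap_agap k; have := agap_gap k; have := gap_ge0 k.
    have : 0 <= beta k * M by rewrite mulr_ge0// ltW.
    by rewrite ler_norml; lra.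
  have h2 : `|rho k / 2 * E k| <= rhi / 2 * E k.
    have /andP[_ hr] := rho_bd k.
    rewrite ger0_norm; last by rewrite mulr_ge0// divr_ge0// ltW.
    by rewrite ler_wpM2r// ler_wpM2r.
  rewrite /V (le_trans (ler_normD _ _))// lerD// (le_trans (ler_normD _ _))// lerD//.
rewrite (_ : 0 = 0 + 0 * M + Num.sqrt B * 0 + rhi / 2 * 0 :> R); last by rewrite mul0r !mulr0 !addr0.
apply: cvgD; last exact: cvgMr.
apply: cvgD; last exact: cvgMr.
by apply: cvgD => //; exact: cvgMl.
Qed.

Lemma primal_rates :
  [/\ exists B, forall k, `|mu k| <= B,
    psummable (fun k => gamma k * (P (x k.+1) + dotp mus (A (x k.+1) - b) - P xs)),
    psummable (fun k => gamma k * `|A (x k) - b| ^+ 2),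
    A (x k) - b @[k --> \oo] --> (0 : Hd) &
    (P (x k) + dotp mus (A (x k) - b) - P xs) @[k --> \oo] --> (0 : R)].
Proof.
have [[B nB] sg sE _] := energy; split.
- exists (Num.sqrt B + `|mus|) => k.
  rewrite -[X in `|X|](subrK mus) (le_trans (ler_normD _ _))// lerD2r.
  by rewrite -[leLHS]normr_id -sqrtr_sqr ler_wsqrtr// nB.
- exact: sg.
- apply: psummable_shift; first by rewrite mulr_ge0// sqr_ge0.
  by apply: psummable_le sE => k; rewrite ?mulr_ge0// ?sqr_ge0// ler_wpM2r// sqr_ge0.
- by apply/norm_cvg0P; exact: e_cvg0.
- exact: gap_cvg0.
Qed.

Lemma dual_distance_cvg : cvg (`|mu k - mus| ^+ 2 @[k --> \oo]).
Proof.
have [_ _ _ rc] := energy.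
have -> : (fun k => `|mu k - mus| ^+ 2) =
    (fun k => 2 / c * (r k - (1 - gamma k) * V k + gamma k * (rho k / 2 * E k))).
  by apply/funext => k; rewrite /r /n; field; rewrite gt_eqF.
have h1 : (fun k => (1 - gamma k) * V k) @ \oo --> (1 - 0) * (0 : R).
  by apply: cvgM; [apply: cvgB; [exact: cvg_cst|exact: gamma_cvg0]|exact: V_cvg0].
have h2 : (fun k => rho k / 2 * E k) @ \oo --> (0 : R).
  apply: (@cvg0_dominated _ _ (fun k => rhi / 2 * E k)).
    move=> k; rewrite ger0_norm; last by rewrite mulr_ge0// divr_ge0// ltW.
    by rewrite ler_wpM2r// ler_wpM2r//; have /andP[] := rho_bd k.
  by rewrite -[X in _ --> X](mulr0 (rhi / 2)); apply: cvgMr; exact: E_cvg0.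
have h3 : (fun k => gamma k * (rho k / 2 * E k)) @ \oo --> (0 * 0 : R).
  exact: (cvgM gamma_cvg0 h2).
apply: is_cvgMr; exact: (is_cvgD (is_cvgB rc (cvgP _ h1)) (cvgP _ h3)).
Qed.

(** The descent inequality contracts the excess of the augmented Lagrangian at [x k] over its value
    at the fixed point [w], so this excess is eventually at most any positive number; and the value
    at [x k] tends to [P xs]. *)
Lemma augmented_lower_bound w d : C w -> 0 < d ->
  \forall k \near \oo, P xs - d <=
    P w + dotp (mu k) (A w - b) + rhi / 2 * `|A w - b| ^+ 2.
Proof.
move=> Cw d0; have d2 : 0 < d / 2 by rewrite divr_gt0.
pose Lx k := Phi k + dotp (mu k) (e k) + rho k / 2 * E k.
pose Lw k := P w + dotp (mu k) (A w - b) + rho k / 2 * `|A w - b| ^+ 2.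
(* The effect of the multiplier update on both values: [E k.+1] at the iterate, at most
   [D * |e k.+1|] at [w]. *)
pose delta k := (E k.+1 + D * `|e k.+1|) / c.
pose sigma k := D ^+ 2 / 2 * (rho k.+1 - rho k) + eps k.
have LxV k : Lx k = V k + P xs by rewrite /Lx /V /agap /p dotpBl; ring.
have dc : delta @ \oo --> (0 : R).
  rewrite (_ : 0 = (0 + D * 0) / c :> R); last by rewrite mulr0 addr0 mul0r.
  apply: cvgMl; apply: cvgD; first by rewrite (cvg_shiftS E).
  by apply: cvgMr; rewrite (cvg_shiftS (fun k => `|e k|)).
have ss : psummable sigma.
  apply: psummableD => //; apply: psummableZ; first by rewrite divr_ge0// sqr_ge0.
  by apply: (@psummable_telescope _ _ rhi) => // k; have /andP[] := rho_bd k.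
have stepQ k : Lx k.+1 - Lw k.+1 <= (1 - gamma k) * (Lx k - Lw k) + gamma k * delta k + sigma k.
  have h := descent k Cw.
  have h0 : 0 <= gamma k * rho k / 2 * `|A (x k - w)| ^+ 2.
    by rewrite mulr_ge0 ?sqr_ge0// divr_ge0// mulr_ge0// ltW.
  have h1 : gamma k / c * - dotp (e k.+1) (A w - b) <= gamma k / c * (D * `|e k.+1|).
    rewrite ler_wpM2l ?divr_ge0// ?(ltW c0)// -dotpNl (le_trans (dotp_le_norm _ _))//.
    by rewrite normrN mulrC ler_wpM2r// Abd.
  have h2 : (rho k.+1 - rho k) / 2 * E k.+1 <= (rho k.+1 - rho k) / 2 * D ^+ 2.
    by rewrite ler_wpM2l// divr_ge0// subr_ge0.
  have h3 : 0 <= (rho k.+1 - rho k) / 2 * `|A w - b| ^+ 2.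
    by rewrite mulr_ge0 ?sqr_ge0// divr_ge0// subr_ge0.
  rewrite /Lx /Lw /delta /sigma muS !dotpDl !dotpZl dotpp -/(E k.+1).
  lra.
have h := contraction_le_eps gamma01 gamma_unb dc ss stepQ d2.
have /cvgrPdist_le /(_ _ d2) hV := V_cvg0.
near=> k.
have h1 : Lx k - Lw k <= d / 2 by near: k.
have : `|0 - V k| <= d / 2 by near: k.
rewrite sub0r normrN ler_norml => /andP[h2 _].
have h3 : rho k / 2 * `|A w - b| ^+ 2 <= rhi / 2 * `|A w - b| ^+ 2.
  by rewrite ler_wpM2r ?sqr_ge0// ler_wpM2r//; have /andP[] := rho_bd k.
by rewrite LxV /Lw in h1; lra.
Unshelve. all: by end_near. Qed.

End saddle_point.

(* The quadratic penalty is removed by moving from [xs] towards [w]: the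
   penalty is of second order in the step. *)
Lemma dual_limit xs mus : C xs -> A xs = b ->
  (forall w, C w -> P xs <= P w + dotp mus (A w - b)) ->
  exists2 mubar, (forall w, C w -> P xs <= P w + dotp mubar (A w - b)) &
    forall w, dotp (mu k) w @[k --> \oo] --> dotp mubar w.
Proof.
move=> Cxs Axs sad.
have [[B muB] _ _ _ _] := primal_rates Cxs Axs sad.
(* The target set consists of the multipliers for which [xs] minimizes the Lagrangian on [C]; the
   energy argument is rerun with each of them. *)
apply: (opial muB) => [m hm|U m PU Uoo Um]; first exact: (@dual_distance_cvg xs).
have aug w : C w -> P xs <= P w + dotp m (A w - b) + rhi / 2 * `|A w - b| ^+ 2.
  move=> Cw; apply/ler_addgt0Pr => d d0.
  have h : P xs - d - P w - rhi / 2 * `|A w - b| ^+ 2 <= dotp m (A w - b).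
    apply: (cvgr_to_ge (Um (A w - b))); apply: Uoo.
    have := augmented_lower_bound Cxs Axs sad Cw d0.
    by apply: filterS => k; lra.
  lra.
move=> w Cw; rewrite -subr_ge0.
apply: (first_order_ge0 (B := rhi / 2 * `|A w - b| ^+ 2)) => t t01.
have h := aug _ (Cconv t01 Cw Cxs); have h2 := Pconv t01 Cw Cxs.
move: h; have -> : A (t *: w + (1 - t) *: xs) - b = t *: (A w - b).
  rewrite linearD !linearZ /= Axs; apply: dotp_inj => z; rewrite !dotpE; ring.
rewrite dotpZr sqr_normZ; lra.
Qed.

Lemma inexact_descent_cvg xs mus : C xs -> A xs = b ->
  (forall w, C w -> P xs <= P w + dotp mus (A w - b)) ->
  [/\ psummable (fun k => gamma k * (P (x k.+1) + dotp mus (A (x k.+1) - b) - P xs)),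
    psummable (fun k => gamma k * `|A (x k) - b| ^+ 2),
    A (x k) - b @[k --> \oo] --> (0 : Hd) &
    (P (x k) + dotp mus (A (x k) - b) - P xs) @[k --> \oo] --> (0 : R)] /\
  exists2 mubar, (forall w, C w -> P xs <= P w + dotp mubar (A w - b)) &
    forall w, dotp (mu k) w @[k --> \oo] --> dotp mubar w.
Proof.
move=> Cxs Axs sad; split; last exact: (dual_limit Cxs Axs sad).
by have [_ sg sE ec gc] := primal_rates Cxs Axs sad; split.
Qed.

End inexact_descent.

(** * Rates and the Lagrangian *)

Section averages.
Context {R : realType}.

Lemma series_le_upto (u v : nat -> R) n : (forall i, (i < n)%N -> u i <= v i) ->
  series u n <= series v n.
Proof.
elim: n => [|n IH] uv; first by rewrite !series0.
by rewrite !seriesSr lerD ?uv// IH// => i /ltnW; exact: uv.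
Qed.

Lemma le_sqrt_ratio (m G S : R) : 0 <= m -> 0 < G -> m ^+ 2 * G <= S ->
  m <= Num.sqrt S * (Num.sqrt G)^-1.
Proof.
move=> m0 G0 h.
have S0 : 0 <= S by apply: le_trans h; rewrite mulr_ge0// ?sqr_ge0// ltW.
have -> : m = Num.sqrt (m ^+ 2) by rewrite sqrtr_sqr ger0_norm.
have -> : Num.sqrt S * (Num.sqrt G)^-1 = Num.sqrt (S / G).
  by rewrite sqrtrM// sqrtrV// ltW.
by apply: ler_wsqrtr; rewrite ler_pdivlMr.
Qed.

(** Induction merging the newest point into the previous average with weight
    [g k.+1 / series g k.+2]. Membership in [C] is carried along since [psi] is convex only
    there. *)
Lemma weighted_jensen (H : hilbertType R) (C : set H) (psi : H -> R)
    (g : nat -> R) (v : nat -> H) :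
  (forall u w t, 0 < t < 1 -> C u -> C w -> C (t *: u + (1 - t) *: w)) ->
  (forall u w t, 0 < t < 1 -> C u -> C w ->
    psi (t *: u + (1 - t) *: w) <= t * psi u + (1 - t) * psi w) ->
  (forall k, 0 < g k) -> (forall k, C (v k)) -> forall k,
  let a := (series g k.+1)^-1 *: \sum_(i < k.+1) g i *: v i in
  C a /\ psi a * series g k.+1 <= series (fun i => g i * psi (v i)) k.+1.
Proof.
move=> Cc pc g0 Cv; elim=> [|k [IHC IHp]].
  rewrite /= !seriesSr !series0 !add0r big_ord1 scalerA mulVf ?gt_eqF// scale1r.
  by rewrite mulrC.
rewrite /=; set a := _ *: _ in IHC IHp.
have sg n : 0 < series g n.+1.
  by rewrite seriesSr ltr_wpDl// series_ge0// => i; exact: ltW.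
pose t := g k.+1 / series g k.+2.
have t01 : 0 < t < 1.
  by rewrite divr_gt0//= ltr_pdivrMr// mul1r [ltRHS]seriesSr ltrDr.
have t1 : (1 - t) * series g k.+2 = series g k.+1.
  by rewrite mulrBl mul1r /t divfK ?gt_eqF// [X in X - _]seriesSr addrK.
have -> : (series g k.+2)^-1 *: \sum_(i < k.+2) g i *: v i =
    t *: v k.+1 + (1 - t) *: a.
  rewrite big_ord_recr /= scalerDr scalerA addrC mulrC; congr (_ + _).
  rewrite /a scalerA; congr (_ *: _); rewrite -t1.
  rewrite invfM mulrA mulfV ?mul1r// gt_eqF// subr_gt0.
  by have /andP[] := t01.
split; first exact: Cc.
have h : psi (t *: v k.+1 + (1 - t) *: a) * series g k.+2 <=
    (t * psi (v k.+1) + (1 - t) * psi a) * series g k.+2.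
  by apply: ler_wpM2r; [exact: ltW (sg _)|exact: (pc _ _ _ t01 (Cv k.+1) IHC)].
apply: (le_trans h); rewrite [leRHS]seriesSr.
have -> : (t * psi (v k.+1) + (1 - t) * psi a) * series g k.+2 =
   t * series g k.+2 * psi (v k.+1) + psi a * ((1 - t) * series g k.+2) by ring.
by rewrite t1 /t divfK ?gt_eqF// addrC lerD2r.
Qed.

Lemma eqO_bound (u v : nat -> R) (B : R) : (forall k, `|u k| <= B * `|v k|) ->
  u =O_\oo v.
Proof.
move=> h; apply/eqO_exP; exists (`|B| + 1); first by rewrite ltr_wpDl.
apply: nearW => k; apply: le_trans (h k) _; rewrite ler_wpM2r//.
by rewrite (le_trans (ler_norm _))// lerDl.
Qed.

Lemma min_weight_le (g q : nat -> R) (m S : R) k : (forall i, 0 <= g i) ->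
  (forall i, (i < k)%N -> m <= q i) -> series (fun i => g i * q i) k <= S ->
  m * series g k <= S.
Proof.
move=> g0 mq; apply: le_trans; rewrite -series_scale; apply: series_le_upto => i ik.
by rewrite mulrC ler_wpM2l// mq.
Qed.

Section rates.
Variable g : nat -> R.
Hypotheses (g0 : forall k, 0 < g k) (g_unb : unbounded_series g).

Let g0' k : 0 <= g k. Proof. exact: ltW. Qed.

Let sg n : 0 < series g n.+1.
Proof. by rewrite seriesSr ltr_wpDl// series_ge0. Qed.

Lemma feasibility_rates (Hp Hd : hilbertType R) (A : {linear Hp -> Hd}) (b : Hd)
    (x : nat -> Hp) :
  psummable (fun k => g k * `|A (x k) - b| ^+ 2) ->
  [/\ (fun k => inf [set `|A (x i) - b| | i in `I_k.+1])
        =O_\oo (fun k => (Num.sqrt (series g k.+1))^-1),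
      exists2 phi : nat -> nat, {homo phi : i j / (i < j)%N} &
        forall j, `|A (x (phi j)) - b| <= (Num.sqrt (series g (phi j).+1))^-1 &
      (fun k => `|A ((series g k.+1)^-1 *: \sum_(i < k.+1) g i *: x i) - b|)
        =O_\oo (fun k => (Num.sqrt (series g k.+1))^-1)].
Proof.
move=> sE; have [_ [S hS]] := sE.
have sqrtV0 k : 0 <= (Num.sqrt (series g k.+1))^-1 by rewrite invr_ge0 sqrtr_ge0.
split.
- apply: (@eqO_bound _ _ (Num.sqrt S)) => k; rewrite [X in _ * X]ger0_norm//.
  set I := [set _ | _ in _].
  have Ilb : has_lbound I by exists 0 => _ [i _ <-].
  have I0 : 0 <= inf I.
    by apply: lb_le_inf => [|_ [i _ <-]//]; exists `|A (x 0%N) - b|, 0%N.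
  rewrite ger0_norm//; apply: le_sqrt_ratio => //.
  apply: (min_weight_le g0' _ (hS _)) => i ik.
  by rewrite ler_sqr ?nnegrE//; apply: ge_inf => //; exists i.
- have [phi phi_lt hphi] := subsequence_of_frequently
    (frequently_le_inv_series g0 g_unb (fun=> sqr_ge0 _) sE).
  exists phi => // j; rewrite -(sqrtrV (ltW (sg _))).
  by rewrite -[leLHS]normr_id -sqrtr_sqr ler_wsqrtr.
- apply: (@eqO_bound _ _ (Num.sqrt S)) => k; rewrite [X in _ * X]ger0_norm// normr_id.
  apply: le_sqrt_ratio => //.
  have [|||_ h] := @weighted_jensen Hp setT (fun u => `|A u - b| ^+ 2) g x _ _ g0 _ k => //.
    move=> u w t /andP[t0 t1] _ _.
    have -> : A (t *: u + (1 - t) *: w) - b = (1 - t) *: (A w - b) + t *: (A u - b).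
      by rewrite linearD !linearZ /=; apply: dotp_inj => v; rewrite !dotpE; ring.
    by rewrite [leRHS]addrC; apply: sqr_norm_conv; rewrite !ltW.
  exact: le_trans h (hS _).
Qed.

Lemma ereal_inf_rate (q : nat -> R) (l : nat -> \bar R) (p : R) :
  (forall k, l k = (p + q k)%:E) -> psummable (fun k => g k * q k) ->
  (forall k, 0 <= q k) ->
  ebigO (fun k => ereal_inf [set l i | i in `I_k.+1] - p%:E)%E
    (fun k => (series g k.+1)^-1).
Proof.
move=> lE [_ [S hS]] q0; exists S; apply: nearW => k.
set I := [set _ | _ in _].
have Ilb : (p%:E <= ereal_inf I)%E.
  by apply: le_ereal_inf_tmp => _ [i _ <-]; rewrite lE lee_fin lerDl.
have Iub i : (i < k.+1)%N -> (ereal_inf I <= (p + q i)%:E)%E.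
  by move=> ik; rewrite -lE; apply: ereal_inf_lbound; exists i.
have := Iub _ (ltn0Sn k); case: (ereal_inf I) Ilb Iub => [r| |]// pr rq _.
rewrite lee_fin in pr; rewrite -EFinB abse_EFin lee_fin !ger0_norm ?subr_ge0//; last by rewrite invr_ge0 ltW.
rewrite ler_pdivlMr//; apply: (min_weight_le g0' _ (hS _)) => i ik.
by have := rq _ ik; rewrite lee_fin lerBlDl.
Qed.

Lemma ereal_average_rate (Hp : hilbertType R) (C : set Hp) (psi : Hp -> R)
    (l : Hp -> \bar R) (v : nat -> Hp) (p : R) :
  (forall u w t, 0 < t < 1 -> C u -> C w -> C (t *: u + (1 - t) *: w)) ->
  (forall u w t, 0 < t < 1 -> C u -> C w ->
    psi (t *: u + (1 - t) *: w) <= t * psi u + (1 - t) * psi w) ->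
  (forall k, C (v k)) -> (forall u, C u -> l u = (p + psi u)%:E) ->
  (forall u, C u -> 0 <= psi u) -> psummable (fun k => g k * psi (v k)) ->
  ebigO (fun k => l ((series g k.+1)^-1 *: \sum_(i < k.+1) g i *: v i)%R - p%:E)%E
    (fun k => (series g k.+1)^-1).
Proof.
move=> Cc pc Cv lE p0 [_ [S hS]]; exists S; apply: nearW => k.
have [Ca ha] := weighted_jensen Cc pc g0 Cv k.
rewrite lE// -EFinB addrC addKr abse_EFin lee_fin !ger0_norm ?p0//; last by rewrite invr_ge0 ltW.
by rewrite ler_pdivlMr// (le_trans ha).
Qed.

End rates.

End averages.

(** * Saddle points of the Lagrangian *)

Section lagrangian.
Context {R : realType} {Hp Hd Hv : hilbertType R}.
Variables (A : {linear Hp -> Hd}) (T : {linear Hp -> Hv}) (b : Hd).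
Variables (f h : Hp -> \bar R) (g : Hv -> \bar R).
Hypotheses (fp : eproper f) (gp : eproper g) (hp : eproper h)
  (fc : econvex f) (gTc : econvex (g \o T)) (hc : econvex h)
  (Cf : dom h `<=` dom f) (Cg : forall u, dom h u -> dom g (T u)).

(** Meaningful on [dom h] only, since [fine] sends [+oo] to [0]; points outside are handled through
    the value [+oo] of the objective. *)
Definition robjective u := fine (f u) + fine (g (T u)) + fine (h u).

Lemma objectiveE u : dom h u -> objective T f h g u = (robjective u)%:E.
Proof.
move=> hu; rewrite /objective (eproper_fin fp (Cf hu)) (eproper_fin gp (Cg hu)).
by rewrite (eproper_fin hp hu) -!EFinD.
Qed.

Lemma objective_out u : ~ dom h u -> objective T f h g u = +oo%E.
Proof.
rewrite /dom /= => /negP; rewrite -leNgt leye_eq /objective => /eqP ->.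
have := proj1 fp u; have := proj1 gp (T u).
by case: (f u) => [r| |]//; case: (g (T u)) => [r'| |].
Qed.

Lemma LagrangianE u m : dom h u ->
  Lagrangian A T b f h g u m = (robjective u + dotp m (A u - b))%:E.
Proof. by move=> hu; rewrite EFinD -objectiveE. Qed.

Lemma Lagrangian_out u m : ~ dom h u -> Lagrangian A T b f h g u m = +oo%E.
Proof.
by move=> hu; rewrite /Lagrangian -/(objective T f h g u) objective_out.
Qed.

Lemma dom_conv u v t : 0 < t < 1 -> dom h u -> dom h v ->
  dom h (t *: u + (1 - t) *: v).
Proof. by move=> t01 hu hv; exact: econvex_dom. Qed.

Lemma robjective_conv u v t : 0 < t < 1 -> dom h u -> dom h v ->
  robjective (t *: u + (1 - t) *: v) <= t * robjective u + (1 - t) * robjective v.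
Proof.
move=> t01 hu hv; rewrite /robjective.
have h1 := econvex_fine fp fc (Cf hu) (Cf hv) t01.
have h2 := econvex_fine hp hc hu hv t01.
have h3 : fine (g (T (t *: u + (1 - t) *: v))) <= t * fine (g (T u)) + (1 - t) * fine (g (T v)).
  have := econvex_fin (f := g \o T) gTc (eproper_fin gp (Cg hu)) (eproper_fin gp (Cg hv)) t01.
  by rewrite /= (eproper_fin gp (Cg (dom_conv t01 hu hv))) lee_fin.
move: h1 h2 h3; move: (fine _) (fine _) (fine _) (fine _) (fine _) (fine _) (fine _) (fine _) (fine _).
by move=> *; lra.
Qed.

(** Finiteness at one point of [dom h] keeps [xs] inside it. Feasibility follows from the multiplier
    inequality tested at [mus + (A xs - b)]. *)
Lemma saddle_pointP xs mus : dom h !=set0 -> saddle_point A T b f h g xs mus ->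
  [/\ dom h xs, A xs = b &
    forall w, dom h w -> robjective xs <= robjective w + dotp mus (A w - b)].
Proof.
move=> [x0 hx0] sad.
have hxs : dom h xs.
  apply: contrapT => /(Lagrangian_out mus) E.
  by have [_] := sad x0 mus; rewrite E LagrangianE.
have Axs : A xs = b.
  have [+ _] := sad xs (mus + (A xs - b)).
  rewrite !LagrangianE// lee_fin dotpDl dotpp => le0.
  have := sqr_ge0 `|A xs - b| => ge0.
  have /eqP : `|A xs - b| ^+ 2 = 0 by lra.
  by rewrite sqrf_eq0 normr_eq0 subr_eq0 => /eqP.
split=> // w hw; have [_] := sad w mus.
by rewrite !LagrangianE// lee_fin Axs subrr dotp0r addr0.
Qed.

Lemma saddle_point_intro xs mus : dom h xs -> A xs = b ->
  (forall w, dom h w -> robjective xs <= robjective w + dotp mus (A w - b)) ->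
  saddle_point A T b f h g xs mus.
Proof.
move=> hxs Axs sad u m; rewrite !(LagrangianE _ hxs) Axs subrr !dotp0r; split=> //.
have [hu|hu] := pselect (dom h u); last by rewrite Lagrangian_out// leey.
by rewrite LagrangianE// lee_fin addr0 sad.
Qed.

(** Weak duality with equality: [- P xs] bounds every dual value from below, by testing the
    conjugate at [xs], and the saddle inequality bounds the value at [mus] by it. *)
Lemma dual_solution_intro xs mus : continuous A -> dom h xs -> A xs = b ->
  (forall w, dom h w -> robjective xs <= robjective w + dotp mus (A w - b)) ->
  dual_solution A T b f h g mus.
Proof.
move=> Ac hxs Axs sad m.
have Ad (k : Hd) u : dotp (- adjoint A k) u = - dotp k (A u).
  by rewrite dotpNl dotpC -adjointP// dotpC.
apply: (@le_trans _ _ (- robjective xs)%:E).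
  rewrite -leeBrDr// -EFinB; apply: ge_ereal_sup => _ [u _ <-].
  rewrite Ad; have [hu|hu] := pselect (dom h u); last by rewrite objective_out//= leNye.
  rewrite objectiveE// -EFinB lee_fin.
  by have := sad _ hu; rewrite dotpBr; lra.
rewrite -leeBlDr// -EFinB; apply: ereal_sup_ubound; exists xs => //.
by rewrite Ad objectiveE// Axs -EFinB; congr (_%:E); ring.
Qed.

Lemma Lagrangian_sublevel_closed mus (a : R) : continuous A ->
  lower_semicontinuous f -> lower_semicontinuous (g \o T) ->
  lower_semicontinuous h ->
  closed [set u | dom h u /\ robjective u + dotp mus (A u - b) <= a].
Proof.
move=> Ac fl gl hl.
(* Passing to the extended Lagrangian excludes points outside [dom h] by its value [+oo], and lower
   semicontinuity then opens the complement. *)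
have -> : [set u | dom h u /\ robjective u + dotp mus (A u - b) <= a] =
    ~` [set u | (a%:E < Lagrangian A T b f h g u mus)%E].
  apply/seteqP; split => u /=.
    by move=> [hu le_a]; rewrite LagrangianE// lte_fin; apply/negP; rewrite -leNgt.
  move=> /negP; rewrite -leNgt; have [hu|hu] := pselect (dom h u).
    by rewrite LagrangianE// lee_fin.
  by rewrite Lagrangian_out.
suff /lower_semicontinuousP/(_ a) : lower_semicontinuous
    (fun u => Lagrangian A T b f h g u mus) by exact: open_closedC.
have fNy u : (-oo < f u)%E by exact: (proj1 fp).
have gNy u : (-oo < (g \o T) u)%E by exact: (proj1 gp).
have hNy u : (-oo < h u)%E by exact: (proj1 hp).
have addNy (u v : \bar R) : (-oo < u -> -oo < v -> -oo < u + v)%E.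
  by case: u v => [u| |] [v| |]//= _ _; rewrite ltNyr.
apply: (@lower_semicontinuousD _ _ (objective T f h g) (fun u => (dotp mus (A u - b))%:E)).
- by move=> u; apply: (addNy _ _ (addNy _ _ (fNy u) (gNy u)) (hNy u)).
- by move=> u; rewrite ltNyr.
- apply: (@lower_semicontinuousD _ _ (fun u => f u + g (T u))%E h) => //.
    by move=> u; exact: (addNy _ _ (fNy u) (gNy u)).
  exact: (@lower_semicontinuousD _ _ f (g \o T)).
apply: (@lower_semicontinuous_fin _ _ (fun u => dotp mus (A u - b))).
move=> u; apply: (continuous_comp (f := fun u => A u - b)); last exact: dotp_continuous.
by apply: cvgB; [exact: Ac|exact: cvg_cst].
Qed.

(** Sublevel sets of the Lagrangian at [mus] are convex and closed, hence contain weak cluster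
    points. They are used rather than those of the objective because the Lagrangian values are the
    ones known to converge; at the feasible [xbar] the pairing disappears. *)
Lemma weak_cluster_primal (x : nat -> Hp) xs mus xbar : continuous A ->
  lower_semicontinuous f -> lower_semicontinuous (g \o T) ->
  lower_semicontinuous h -> dom h xs -> A xs = b ->
  (forall k, dom h (x k)) -> A (x k) - b @[k --> \oo] --> (0 : Hd) ->
  (robjective (x k) + dotp mus (A (x k) - b) - robjective xs) @[k --> \oo] --> (0 : R) ->
  weak_cluster_point x xbar ->
  [/\ dom h xbar, A xbar = b & robjective xbar <= robjective xs].
Proof.
move=> Ac fl gl hl hxs Axs hx xb xP xbarc.
have Axb : A xbar = b.
  apply: dotp_inj => v; rewrite (adjointP Ac).
  apply: (weak_cluster_dotp xbarc); apply/cvgrPdist_le => d d0.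
  have h1 : (fun k => dotp v (A (x k) - b)) @ \oo --> (0 : R).
    rewrite -(dotp0r v); apply: continuous_cvg; last exact: xb.
    exact: dotp_continuous.
  have /cvgrPdist_le /(_ _ d0) := h1; apply: filterS => k.
  by rewrite -(adjointP Ac) sub0r normrN dotpBr distrC !(dotpC v).
have key d : 0 < d -> dom h xbar /\ robjective xbar + dotp mus (A xbar - b) <= robjective xs + d.
  move=> d0.
  apply: (weak_cluster_closed_convex _ _ _ xbarc (S := [set u | dom h u /\ robjective u + dotp mus (A u - b) <= robjective xs + d])).
  - exact: Lagrangian_sublevel_closed.
  - move=> u v t t01 [hu lu] [hv lv]; split; first exact: dom_conv.
    have cv := robjective_conv t01 hu hv.
    have -> : dotp mus (A (t *: u + (1 - t) *: v) - b) = t * dotp mus (A u - b) + (1 - t) * dotp mus (A v - b).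
      by rewrite linearD !linearZ /= !dotpE; ring.
    have /andP[t0 t1] := t01.
    have : t * (robjective u + dotp mus (A u - b)) <= t * (robjective xs + d) by rewrite ler_pM2l.
    have : (1 - t) * (robjective v + dotp mus (A v - b)) <= (1 - t) * (robjective xs + d).
      by rewrite ler_pM2l// subr_gt0.
    lra.
  - have /cvgrPdist_le /(_ _ d0) := xP; apply: filterS => k /=.
    rewrite sub0r normrN ler_norml => /andP[_ le_d]; split; first exact: hx.
    lra.
have [hxb _] := key 1 ltr01.
split=> //; apply/ler_addgt0Pr => d /key[_].
by rewrite Axb subrr dotp0r addr0.
Qed.

End lagrangian.

(* One conditional gradient step on the smoothed augmented Lagrangian. The
   quadratic penalty makes its linearization at [x] loose by
   [rho / 2 * |A (x - w)|^2]. *)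
Lemma conditional_gradient_step (R : realType) (Hp Hd Hv : hilbertType R)
    (A : {linear Hp -> Hd}) (T : {linear Hp -> Hv}) (b mu : Hd)
    (x x' s w gf z : Hp) (u : Hv)
    (fx fx' fw hx hx' hs hw G G' gw gam rho k2 zt dl BT BA : R) :
  0 <= gam -> 0 <= rho -> 0 <= k2 ->
  x' = x + gam *: (s - x) ->
  (forall v, dotp z v = dotp gf v + dotp u (T v) + dotp mu (A v)
     + rho * dotp (A x - b) (A v)) ->
  fx + dotp gf (w - x) <= fw ->
  fx' <= fx + gam * dotp gf (s - x) + zt ->
  G + dotp u (T w - T x) <= gw ->
  G' <= G + dotp u (T x' - T x) + k2 * `|T x' - T x| ^+ 2 + dl ->
  hx' <= gam * hs + (1 - gam) * hx ->
  hs + dotp z s <= hw + dotp z w ->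
  `|T (s - x)| ^+ 2 <= BT -> `|A (s - x)| ^+ 2 <= BA ->
  fx' + G' + hx' + dotp mu (A x' - b) + rho / 2 * `|A x' - b| ^+ 2 <=
  (1 - gam) * (fx + G + hx + dotp mu (A x - b) + rho / 2 * `|A x - b| ^+ 2)
  + gam * (fw + gw + hw + dotp mu (A w - b) + rho / 2 * `|A w - b| ^+ 2)
  - gam * rho / 2 * `|A (x - w)| ^+ 2
  + (zt + dl + k2 * gam ^+ 2 * BT + rho / 2 * gam ^+ 2 * BA).
Proof.
move=> gam0 rho0 k20 x'E zE f1 f2 g1 g2 h1 s1 hBT hBA.
have Tx' : T x' - T x = gam *: T (s - x).
  by rewrite x'E linearD linearZ addrC addKr.
have Ax' : A x' - b = (A x - b) + gam *: A (s - x).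
  by rewrite x'E linearD linearZ addrAC.
have Aw : A w - b = (A x - b) - A (x - w).
  by rewrite linearB; apply: dotp_inj => v; rewrite !dotpE; ring.
have zs : dotp z (s - x) <= hw - hs + dotp z (w - x) by rewrite !dotpBr; lra.
rewrite !zE in zs.
have Awx : A (w - x) = - A (x - w) by rewrite -linearN opprB.
rewrite Awx !dotpNr (linearB T w) /= in zs.
rewrite Tx' sqr_normZ dotpZr in g2.
rewrite Ax' Aw (sqr_normD (A x - b) (gam *: _)) (sqr_normB (A x - b)) sqr_normZ.
rewrite (dotpDr mu (A x - b)) (dotpBr mu (A x - b)) !dotpZr.
have p1 : k2 * gam ^+ 2 * `|T (s - x)| ^+ 2 <= k2 * gam ^+ 2 * BT.
  by rewrite ler_wpM2l// mulr_ge0// sqr_ge0.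
have p2 : rho / 2 * gam ^+ 2 * `|A (s - x)| ^+ 2 <= rho / 2 * gam ^+ 2 * BA.
  by rewrite ler_wpM2l// mulr_ge0 ?sqr_ge0// divr_ge0.
have p3 := ler_wpM2l gam0 zs.
have p4 := ler_wpM2l gam0 f1.
have p5 := ler_wpM2l gam0 g1.
move: f2 g2 h1 p1 p2 p3 p4 p5; clear.
move: (dotp gf _) (dotp gf _) (dotp u _) (dotp u _) (dotp mu (A x - b)).
move: (dotp mu (A (s - x))) (dotp mu (A (x - w))) (dotp (A x - b) (A (s - x))) (dotp (A x - b) (A (x - w))).
by move: (`|T (s - x)|) (`|A (s - x)|) (`|A x - b|) (`|A (x - w)|) => *; lra.
Qed.

(** * Convergence of the algorithm *)

Theorem theorem4p2 (R : realType) (Hp Hd Hv : hilbertType R)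
    (A : {linear Hp -> Hd}) (T : {linear Hp -> Hv}) (b : Hd)
    (f h : Hp -> \bar R) (g : Hv -> \bar R)
    (F : Hp -> \bar R) (zeta : R -> R) (Lh : R)
    (gamma beta theta rho : nat -> R) (Mlo Mhi c : R)
    (x : nat -> Hp) (y : nat -> Hv) (z s : nat -> Hp) (mu : nat -> Hd)
    (A_bounded : continuous A) (T_bounded : continuous T)
    (g_Gamma0 : Gamma0 g)
    (f_Gamma0 : Gamma0 f) (gT_Gamma0 : Gamma0 (g \o T)) (h_Gamma0 : Gamma0 h)
    (F_gtNy : forall v, (-oo < F v)%E)
    (zeta_ge0 : forall t, 0 < t <= 1 -> 0 <= zeta t)
    (f_smooth : Gzeta_smooth F zeta f (dom h))
    (C_compact : weakly_compact (dom h))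
    (TC_dom : T @` dom h `<=` dom_subdiff g)
    (subgrad_bounded :
      has_ubound [set `|min_subgradient g (T v)| | v in dom h])
    (Lh_ge0 : 0 <= Lh)
    (h_lip : forall v w, dom h v -> dom h w ->
      (`|h v - h w| <= (Lh * `|v - w|)%:E)%E)
    (saddle_ex : exists xs mus, saddle_point A T b f h g xs mus)
    (ranA_closed : closed (range A))
    (qualification :
      ([set v | A v = b] `&` (dom (g \o T))° `&` (dom h)°) !=set0 \/
      [/\ finite_dim Hp, finite_dim Hd,
          ([set v | A v = b] `&` rel_interior (dom (g \o T))
             `&` rel_interior (dom h)) !=set0 &
          range (adjoint A) `&` orth (LinHull (dom (g \o T) `&` dom h))
            = [set 0]])
    (gamma_itv : forall k, 0 < gamma k <= 1)
    (beta_gt0 : forall k, 0 < beta k)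
    (theta_ge0 : forall k, 0 <= theta k)
    (rho_ge0 : forall k, 0 <= rho k)
    (zeta_ell1 : ell1_plus (fun k => zeta (gamma k)))
    (gamma2_ell1 : ell1_plus (fun k => gamma k ^+ 2 / beta k))
    (gammabeta_ell1 : ell1_plus (fun k => gamma k * beta k))
    (gamma_notin_ell1 : ~ ell1 gamma)
    (beta_noninc : nonincreasing_seq beta)
    (beta_cvg0 : beta k @[k --> \oo] --> 0)
    (rho_nondec : nondecreasing_seq rho)
    (rho_inf_gt0 : 0 < inf (range rho))
    (rho_bounded : has_ubound (range rho))
    (Mlo_ge1 : 1 <= Mlo) (Mhi_gt0 : 0 < Mhi)
    (gamma_ratio : forall k, Mlo <= gamma k / gamma k.+1 <= Mhi)
    (c_gt0 : 0 < c)
    (thetaE : forall k, theta k = gamma k / c)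
    (c_large : Mhi / c - inf (range rho) / 2 < 0)
    (rho_gamma : forall k,
      rho k.+1 - rho k - gamma k.+1 * rho k.+1 + 2 / c * gamma k
        - gamma k ^+ 2 / c <= gamma k.+1)
    (iter : iterates A T b f h g gamma beta theta rho x y z s mu)
    (xs : Hp) (mus : Hd) (saddle : saddle_point A T b f h g xs mus) :
  let Gam k := series gamma k.+1 in
  let L := Lagrangian A T b f h g in
  [/\ A (x k) @[k --> \oo] --> b,
      (fun k => inf [set `|A (x i) - b| | i in `I_k.+1])
        =O_\oo (fun k => (Num.sqrt (Gam k))^-1),
      (exists2 phi : nat -> nat, {homo phi : i j / (i < j)%N} &
        forall j, `|A (x (phi j)) - b| <= (Num.sqrt (Gam (phi j)))^-1) &
      (fun k => `|A ((Gam k)^-1 *: \sum_(i < k.+1) gamma i *: x i) - b|)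
        =O_\oo (fun k => (Num.sqrt (Gam k))^-1)] /\
  L (x k) mus @[k --> \oo] --> L xs mus /\
  (exists mubar : Hd,
    [/\ weak_cvg mu mubar, dual_solution A T b f h g mubar &
        forall xbar, weak_cluster_point x xbar ->
          primal_solution A T b f h g xbar /\
          saddle_point A T b f h g xbar mubar]) /\
  (ebigO (fun k => ereal_inf [set L (x i) mus | i in `I_k.+1] - L xs mus)%E
     (fun k => (Gam k)^-1) /\
   exists2 phi : nat -> nat, {homo phi : i j / (i < j)%N} &
     forall j, (L (x (phi j).+1) mus - L xs mus <= ((Gam (phi j))^-1)%:E)%E) /\
  ebigO (fun k =>
      L ((Gam k)^-1 *: \sum_(i < k.+1) gamma i *: x i.+1) mus - L xs mus)%E
    (fun k => (Gam k)^-1).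

Proof.
have [fp fc fl] := f_Gamma0; have [hp hc hl] := h_Gamma0.
have [gp _ _] := g_Gamma0; have [_ gTc gTl] := gT_Gamma0.
have [x00 _ yE zE sE xE muE] := iter.
have [Cf [K K0 [f_ge f_desc]]] := Gzeta_smooth_descent F_gtNy zeta_ge0 fp fc
  (convex_dom hp hc) f_smooth.
have gsub u : dom h u -> dom_subdiff g (T u) by move=> hu; apply: TC_dom; exists u.
have Cg u (hu : dom h u) : dom g (T u) := subdiff_dom gp (gsub u hu).
have [d d0 Cd] := weakly_compact_bounded C_compact.
have [KA KA0 hKA] := linear_bound A_bounded.
have [KT KT0 hKT] := linear_bound T_bounded.
pose w0 u := min_subgradient g (T u).
have w0P u (hu : dom h u) : subdiff g (T u) (w0 u) := min_subgradientP gp (gsub u hu).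
have [M w0M] : exists M, forall u, dom h u -> `|w0 u| <= M.
  by have [M hM] := subgrad_bounded; exists M => u hu; apply: hM; exists u.
clearbody w0.
have M0 : 0 <= M by exact: le_trans (w0M _ x00).
(* Comparison with [x 0], where [h] is finite, excludes the value [+oo] at the minimizer. *)
have Cs k : dom h (s k).
  have := sE k (x 0%N); rewrite /dom /=.
  rewrite (eproper_fin hp x00) -EFinD.
  by case: (h (s k)) => [r| |]//=; rewrite ltry.
have g0 k : 0 < gamma k by have /andP[] := gamma_itv k.
have g0' k : 0 <= gamma k by exact: ltW.
have g1 k : gamma k <= 1 by have /andP[] := gamma_itv k.
have xS k : x k.+1 = x k + gamma k *: (s k - x k).
  by rewrite xE -scalerN opprB.
have xconv k : x k.+1 = gamma k *: s k + (1 - gamma k) *: x k.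
  by rewrite xS; apply: dotp_inj => w; rewrite !dotpE; ring.
have Cx k : dom h (x k).
  elim: k => // k IH; rewrite xconv.
  have := g1 k; rewrite le_eqVlt => /orP[/eqP ->|lt1].
    by rewrite subrr scale0r addr0 scale1r.
  by apply: dom_conv => //; rewrite g0.
have diam u v : dom h u -> dom h v -> `|u - v| <= 2 * d.
  move=> hu hv; rewrite (le_trans (ler_normB _ _))//.
  by have := Cd _ hu; have := Cd _ hv; lra.
have [gf [gfE gf_ge gf_desc]] : exists gf : Hp -> Hp, [/\ forall k, gradient f (x k) = gf (x k),
    forall u v, dom h u -> dom h v -> fine (f u) + dotp (gf u) (v - u) <= fine (f v) &
    forall u v t, dom h u -> dom h v -> 0 < t <= 1 ->
      fine (f (u + t *: (v - u))) <= fine (f u) + t * dotp (gf u) (v - u) + K * zeta t].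
  by exists (gradient f); split.
clear f_ge f_desc.
pose fr u := fine (f u); pose hr u := fine (h u); pose gr u := fine (g (T u)).
(* The tangent at [x 0] bounds [f] from below; the smoothness inequality with [t = 1] bounds it from
   above by the same tangent plus [K * zeta 1]. *)
have [Bf hBf] : exists B, forall u, dom h u -> `|fr u| <= B.
  exists (`|fr (x 0%N)| + `|gf (x 0%N)| * (2 * d) + K * zeta 1) => u hu.
  have h1 := gf_ge _ _ x00 hu.
  have h2 := gf_desc _ _ 1 x00 hu (introT andP (conj ltr01 (lexx _))).
  rewrite scale1r mul1r addrC subrK in h2.
  have h3 : `|dotp (gf (x 0%N)) (u - x 0%N)| <= `|gf (x 0%N)| * (2 * d).
    by rewrite (le_trans (norm_dotp_le _ _))// ler_wpM2l// diam.
  have h4 : 0 <= K * zeta 1 by rewrite mulr_ge0// zeta_ge0// ltr01 lexx.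
  have h5 := ler_norm (fr (x 0%N)).
  have h7 : - fr (x 0%N) <= `|fr (x 0%N)| by rewrite -normrN ler_norm.
  move: h3; rewrite !ler_norml => /andP[h8 h9].
  move: h1 h2 h4 h5 h7 h8 h9; rewrite -/(fr u) -/(fr (x 0%N)).
  by clear; move: (fr u) (fr (x 0%N)) (dotp _ _) => *; lra.
have [Bg hBg] : exists B, forall u, dom h u -> `|gr u| <= B.
  exists (`|gr (x 0%N)| + M * (KT * (2 * d))) => u hu.
  (* Bounded subgradients make [gr] Lipschitz on [dom h], whose diameter is finite. *)
  have key p q : dom h p -> dom h q -> gr p <= gr q + M * (KT * (2 * d)).
    move=> hp' hq; have h1 := subdiff_le gp (w0P _ hp') (Cg _ hq) (Cg _ hp').
    have h2 : - dotp (w0 p) (T q - T p) <= M * (KT * (2 * d)).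
      rewrite -dotpNr (le_trans (dotp_le_norm _ _))// normrN -linearB.
      rewrite ler_pM// ?w0M// (le_trans (hKT _))// ler_wpM2l// diam//.
    by move: h1 h2; rewrite /gr; clear; move: (dotp _ _) (fine _) (fine _) => *; lra.
  have := key _ _ x00 hu; have := key _ _ hu x00.
  have := ler_norm (gr (x 0%N)); have : - gr (x 0%N) <= `|gr (x 0%N)| by rewrite -normrN ler_norm.
  by rewrite ler_norml; clear; move: (gr u) (gr (x 0%N)) => *; lra.
have [Bh hBh] : exists B, forall u, dom h u -> `|hr u| <= B.
  exists (`|hr (x 0%N)| + Lh * (2 * d)) => u hu.
  have := h_lip _ _ hu x00.
  rewrite (eproper_fin hp hu) (eproper_fin hp x00) -EFinB lee_fin => h1.
  rewrite -/(hr u) -/(hr (x 0%N)) in h1.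
  rewrite -[X in `|X|](subrK (hr (x 0%N))) addrC (le_trans (ler_normD _ _))// lerD2l.
  by rewrite (le_trans h1)// ler_wpM2l// diam.
pose P := robjective T f h g.
have PBd u : dom h u -> `|P u| <= Bf + Bg + Bh.
  move=> hu; rewrite /P /robjective (le_trans (ler_normD _ _))// lerD//; last exact: hBh.
  by rewrite (le_trans (ler_normD _ _))// lerD//; [exact: hBf|exact: hBg].
pose D := KA * d + `|b|.
have ABd u : dom h u -> `|A u - b| <= D.
  move=> hu; rewrite (le_trans (ler_normB _ _))// lerD2r (le_trans (hKA _))//.
  by rewrite ler_wpM2l// Cd.
(* Smoothing enters the rest of the argument through these five facts only. *)
have [G [u [GP leG Gmin Gstep zP]]] : exists (G : nat -> R) (u : nat -> Hv), [/\
    forall k, G k <= gr (x k), forall k, gr (x k) <= G k + beta k * (M ^+ 2 / 2),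
    forall k w, dom h w -> G k + dotp (u k) (T w - T (x k)) <= gr w,
    forall k, G k.+1 <= G k + dotp (u k) (T (x k.+1) - T (x k))
      + (2 * beta k)^-1 * `|T (x k.+1) - T (x k)| ^+ 2
      + (beta k - beta k.+1) / 2 * M ^+ 2 &
    forall k v, dotp (z k) v = dotp (gf (x k)) v + dotp (u k) (T v)
      + dotp (mu k) (A v) + rho k * dotp (A (x k) - b) (A v)].
  have M2 k : `|w0 (x k)| ^+ 2 <= M ^+ 2 by rewrite ler_sqr ?nnegrE// w0M.
  exists (fun k => moreau g (beta k) (T (x k))), (fun k => moreau_grad g (beta k) (T (x k))).
  split => [k|k|k w hw|k|k v].
  - exact: (moreau_le g_Gamma0 (beta_gt0 k) (gsub _ (Cx k))).
  - apply: (le_trans (le_moreau g_Gamma0 (beta_gt0 k) (w0P _ (Cx k)))).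
    rewrite lerD2l (_ : beta k * (M ^+ 2 / 2) = beta k / 2 * M ^+ 2); last by ring.
    by rewrite ler_wpM2l// divr_ge0// ltW.
  - exact: (moreau_minorant g_Gamma0 (beta_gt0 k) (gsub _ (Cx k)) (Cg _ hw)).
  - apply: (le_trans (moreau_step g_Gamma0 (beta_gt0 k.+1) (beta_noninc _ _ (leqnSn k)) (gsub _ (Cx k)) (w0P _ (Cx k.+1)))).
    by rewrite lerD2l ler_wpM2l// divr_ge0// subr_ge0; exact: beta_noninc.
  - rewrite zE gfE 3!dotpDl !dotpZl !(dotpC (adjoint _ _)) -!adjointP//.
    by rewrite (dotpC (T v)) !(dotpC (A v)) yE.
have rho_bd k : inf (range rho) <= rho k.
  by apply: ge_inf; [exists 0 => _ [i _ <-]|exists k].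
have [rhi rho_ub] := rho_bounded.
have rho_le k : rho k <= rhi by apply: rho_ub; exists k.
have rhi0 : 0 <= rhi by exact: le_trans (rho_le 0%N).
have beta_dec k : beta k.+1 <= beta k by exact: beta_noninc.
have beta_le k : beta k <= beta 0%N by exact: beta_noninc.
have ratio k : gamma k / gamma k.+1 * gamma k.+1 = gamma k by rewrite divfK// gt_eqF.
have gamma_dec k : gamma k.+1 <= gamma k.
  rewrite -[leRHS]ratio ler_peMl// (le_trans Mlo_ge1)//.
  by have /andP[] := gamma_ratio k.
have gamma_Mhi k : gamma k <= Mhi * gamma k.+1.
  by rewrite -[leLHS]ratio ler_wpM2r//; have /andP[] := gamma_ratio k.
have gamma_unb := notin_ell1_unbounded g0' gamma_notin_ell1.
have sg2b := ell1_plus_psummable gamma2_ell1.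
(* Since [beta] is nonincreasing, [gamma^2 <= beta 0 * (gamma^2 / beta)]. This serves the penalty
   error and also gives convergence of [gamma] to [0]. *)
have sg2 : psummable (fun k => gamma k ^+ 2).
  apply: (psummable_le _ _ (psummableZ (ltW (beta_gt0 0%N)) sg2b)) => k; first exact: sqr_ge0.
  rewrite mulrA ler_pdivlMr// mulrC ler_wpM2r// sqr_ge0//.
have gamma_cvg0 : gamma @ \oo --> (0 : R).
  have -> : gamma = (fun k => Num.sqrt (gamma k ^+ 2)).
    by apply/funext => k; rewrite sqrtr_sqr ger0_norm.
  rewrite -[X in _ --> X](@sqrtr0 R); apply: continuous_cvg.
    exact: sqrt_continuous.
  exact: psummable_cvg0 sg2.
pose BT := (KT * (2 * d)) ^+ 2; pose BA := (KA * (2 * d)) ^+ 2.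
(* In order: smoothness error of [f], decrease of the smoothing parameter, curvature [1 / beta] of
   the envelope, curvature of the quadratic penalty. *)
pose eps k := K * zeta (gamma k) + (beta k - beta k.+1) / 2 * M ^+ 2
  + (2 * beta k)^-1 * gamma k ^+ 2 * BT + rho k / 2 * gamma k ^+ 2 * BA.
have BT0 : 0 <= BT by exact: sqr_ge0.
have BA0 : 0 <= BA by exact: sqr_ge0.
have eps_sum : psummable eps.
  have hb : psummable (fun k => beta k - beta k.+1).
    have /= := @psummable_telescope _ (fun k => - beta k) 0.
    under eq_fun do rewrite opprK addrC.
    by apply => k; rewrite ?lerN2// oppr_le0 ltW.
  have z0 k : 0 <= zeta (gamma k) by exact: zeta_ge0.
  have M20 : 0 <= M ^+ 2 / 2 by rewrite divr_ge0// sqr_ge0.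
  have BT20 : 0 <= BT / 2 by rewrite divr_ge0.
  have BA20 : 0 <= rhi / 2 * BA by rewrite mulr_ge0// divr_ge0.
  apply: (psummable_le _ _ (psummableD (psummableD (psummableD (psummableZ K0 (ell1_plus_psummable zeta_ell1)) (psummableZ M20 hb)) (psummableZ BT20 sg2b)) (psummableZ BA20 sg2))) => k.
    rewrite /eps !addr_ge0// !mulr_ge0// ?sqr_ge0// ?invr_ge0// ?subr_ge0// ?mulr_ge0// ltW//.
  rewrite /eps; apply: lerD; first apply: lerD; first apply: lerD => //.
  - by rewrite mulrAC mulrC mulrA mulrAC [X in X * _ <= _]mulrC.
  - by rewrite invfM le_eqVlt; apply/orP; left; apply/eqP; ring.
  - rewrite mulrAC ler_wpM2r ?sqr_ge0// ler_wpM2r// ler_wpM2r//.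
have muS k : mu k.+1 = mu k + (gamma k / c) *: (A (x k.+1) - b).
  by rewrite muE thetaE.
have descent k w : dom h w ->
    fr (x k.+1) + G k.+1 + hr (x k.+1) + dotp (mu k) (A (x k.+1) - b) + rho k / 2 * `|A (x k.+1) - b| ^+ 2 <=
    (1 - gamma k) * (fr (x k) + G k + hr (x k) + dotp (mu k) (A (x k) - b) + rho k / 2 * `|A (x k) - b| ^+ 2)
    + gamma k * (P w + dotp (mu k) (A w - b) + rho k / 2 * `|A w - b| ^+ 2)
    - gamma k * rho k / 2 * `|A (x k - w)| ^+ 2 + eps k.
  move=> hw; apply: (@conditional_gradient_step _ _ _ _ A T b (mu k) (x k) (x k.+1) (s k) w
    (gf (x k)) (z k) (u k) _ _ (fr w) _ _ (hr (s k)) (hr w) _ _ (gr w)) => //.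
  - by rewrite invr_ge0 mulr_ge0// ltW.
  - exact: gf_ge.
  - by rewrite xS; apply: gf_desc.
  - exact: Gmin.
  - by rewrite xconv; have := g1 k; rewrite le_eqVlt => /orP[/eqP ->|lt1];
      [rewrite subrr scale0r addr0 scale1r mul1r mul0r addr0|apply: econvex_fine => //; rewrite g0].
  - have := sE k w; rewrite (eproper_fin hp hw) (eproper_fin hp (Cs k)).
    by rewrite -!EFinD lee_fin.
  - rewrite ler_sqr ?nnegrE ?mulr_ge0// (le_trans (hKT _))// ler_wpM2l// diam//.
  - rewrite ler_sqr ?nnegrE ?mulr_ge0// (le_trans (hKA _))// ler_wpM2l// diam//.
have hne : dom h !=set0 by exists (x 0%N).
have [hxs Axs sad] := saddle_pointP fp gp hp Cf Cg hne saddle.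
have Pconv a v t : 0 < t < 1 -> dom h a -> dom h v -> P (t *: a + (1 - t) *: v) <= t * P a + (1 - t) * P v.
  by move=> t01 ha hv; exact: robjective_conv.
have Cconv a v t : 0 < t < 1 -> dom h a -> dom h v -> dom h (t *: a + (1 - t) *: v).
  by move=> t01 ha hv; exact: dom_conv.
have [[sgap sfeas e0 gap0] [mubar sadbar mubarP]] :
  [/\ psummable (fun k => gamma k * (P (x k.+1) + dotp mus (A (x k.+1) - b) - P xs)),
    psummable (fun k => gamma k * `|A (x k) - b| ^+ 2),
    A (x k) - b @[k --> \oo] --> (0 : Hd) &
    (P (x k) + dotp mus (A (x k) - b) - P xs) @[k --> \oo] --> (0 : R)] /\
  exists2 mubar, (forall w, dom h w -> P xs <= P w + dotp mubar (A w - b)) &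
    forall w, dotp (mu k) w @[k --> \oo] --> dotp mubar w.
  apply: (@inexact_descent_cvg _ _ _ A b (dom h) P (fun k => fr (x k) + G k + hr (x k))
    gamma beta rho eps c Mhi (inf (range rho)) rhi (M ^+ 2 / 2) D (Bf + Bg + Bh) x s mu) => //.
  - lra.
  - by move=> k; rewrite rho_bd rho_le.
  - by move=> k; exact: rho_nondec.
  - exact: ell1_plus_psummable.
  - by rewrite divr_ge0// sqr_ge0.
  - by move=> k; have := GP k; rewrite /P /robjective -/(fr _) -/(hr _) -/(gr _); lra.
  - by move=> k; have := leG k; rewrite /P /robjective -/(fr _) -/(hr _) -/(gr _); lra.
move=> Gam L.
pose gap q := P q + dotp mus (A q - b) - P xs.
have gap_ge0 q : dom h q -> 0 <= gap q by move=> hu; rewrite subr_ge0; exact: sad.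
have LE q : dom h q -> L q mus = (P xs + gap q)%:E.
  move=> hu; rewrite /L LagrangianE//; congr (_%:E).
  by rewrite /gap (addrC (P xs)) subrK.
have LxsE : L xs mus = (P xs)%:E.
  by rewrite /L LagrangianE// Axs subrr dotp0r addr0.
have gap_conv q w t : 0 < t < 1 -> dom h q -> dom h w ->
    gap (t *: q + (1 - t) *: w) <= t * gap q + (1 - t) * gap w.
  move=> t01 hu hw; have := Pconv _ _ _ t01 hu hw; rewrite /gap.
  have -> : dotp mus (A (t *: q + (1 - t) *: w) - b) =
      t * dotp mus (A q - b) + (1 - t) * dotp mus (A w - b).
    by rewrite linearD !linearZ /= !dotpE; ring.
  by clear; move: (P _) (P q) (P w) (P xs) (dotp _ _) (dotp _ _) => *; lra.
(* The energy weighs the gap at [x k.+1] by [gamma k], whereas the infimum starts at [x 0]; the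
   monotonicity of [gamma] permits the shift. *)
have sgap0 : psummable (fun k => gamma k * gap (x k)).
  apply: psummable_shift; first by rewrite mulr_ge0// gap_ge0.
  by apply: psummable_le sgap => k; rewrite ?mulr_ge0// ?gap_ge0// ler_wpM2r// gap_ge0.
have [inf_rate phi_rate avg_rate] := feasibility_rates g0 gamma_unb sfeas.
split; first split => //.
  rewrite -[X in _ --> X]add0r (_ : (fun k => A (x k)) = (fun k => (A (x k) - b) + b)).
    by apply: cvgD => //; exact: cvg_cst.
  by apply/funext => k; rewrite subrK.
split.
  rewrite LxsE (_ : (fun k => L (x k) mus) = (fun k => (P xs + gap (x k))%:E)); last first.
    by apply/funext => k; rewrite LE.
  apply: cvg_EFin; first by apply: nearW.
  rewrite -[X in _ --> X]addr0; apply: cvgD; first exact: cvg_cst.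
  exact: gap0.
split.
  exists mubar; split.
  - exact: weak_cvgP.
  - exact: (dual_solution_intro fp gp hp Cf Cg A_bounded hxs Axs).
  move=> xbar xbarc.
  have [hxb Axb Pxb] := weak_cluster_primal fp gp hp fc gTc hc Cf Cg A_bounded
    fl gTl hl hxs Axs Cx e0 gap0 xbarc.
  split.
    split=> // x' Ax'; rewrite (objectiveE fp gp hp Cf Cg hxb).
    have [hx'|hx'] := pselect (dom h x'); last by rewrite objective_out// leey.
    rewrite (objectiveE fp gp hp Cf Cg hx') lee_fin (le_trans Pxb)//.
    by have := sad _ hx'; rewrite Ax' subrr dotp0r addr0.
  apply: saddle_point_intro => // w hw; exact: le_trans Pxb (sadbar _ hw).
split; last first.
  rewrite LxsE; exact: (@ereal_average_rate R gamma g0 Hp (dom h) gap (L^~ mus)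
    (fun k => x k.+1) (P xs) Cconv gap_conv (fun k => Cx k.+1) LE gap_ge0 sgap).
split.
  rewrite LxsE; exact: (@ereal_inf_rate R gamma g0 (fun k => gap (x k))
    (fun k => L (x k) mus) (P xs) (fun k => LE _ (Cx k)) sgap0
    (fun k => gap_ge0 _ (Cx k))).
have [phi phi_lt hphi] := subsequence_of_frequently
  (frequently_le_inv_series g0 gamma_unb (fun k => gap_ge0 _ (Cx k.+1)) sgap).
exists phi => // j; rewrite LE// LxsE -EFinB lee_fin addrC addKr.
exact: hphi.
Qed.
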